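(* Let $d\ge1$ and let $\mathcal{L}\subseteq\mathbb{R}^d$ be a lattice. There exists a constant $C_{d,\mathcal{L}}$, depending only on $d$ and $\mathcal{L}$, such that the following holds. Let $\mathcal{A}$ be a finite alphabet (with the discrete metric), $N\ge1$, and let $H=(H_\xi)_{\xi\in\mathcal{A}^{\mathcal{L}}}$ be a strongly pattern equivariant Hamiltonian with finite range $\mathcal{R}$ and strongly pattern equivariant coefficients $t_h$, $h\in\mathcal{R}$. Then the map $\Xi\mapsto\sigma(H_\Xi)$ is Lipschitz continuous: for all subshifts $\Xi,\Theta\in\mathcal{J}$, $$d_H\big(\sigma(H_\Xi),\sigma(H_\Theta)\big)\;\le\; C_{d,\mathcal{L}}\;C_{hop}\;R_H\;\|H\|_1\;d^H_{\mathcal{A}^{\mathcal{L}}}(\Xi,\Theta).$$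
   Context: Notation on $\mathbb{R}^d$: $|x|$ is the Euclidean norm, $|x|_{\max}=\max_j|x_j|$. A lattice is $\mathcal{L}=M\mathbb{Z}^d$ with $M$ an invertible real $d\times d$ matrix (fixed). For $r>0$, $Q_r:=\{Mx : x\in\mathbb{R}^d,\ |x|_{\max}\le r\}$. Configurations: $\mathcal{A}$ is finite with the discrete metric $d_{\mathcal{A}}$; $\mathcal{A}^{\mathcal{L}}=\{\xi:\mathcal{L}\to\mathcal{A}\}$ carries the metric $$d_{\mathcal{A}^{\mathcal{L}}}(\xi,\eta):=\min\Big\{\inf\big\{\tfrac1r : r\in(0,\infty),\ d_{\mathcal{A}}(\xi(x),\eta(x))\le\tfrac1r\ \text{for all }x\in Q_r\cap\mathcal{L}\big\},\,1\Big\}$$ ($\inf\emptyset=+\infty$), which induces the product topology. The shift is $(\tau^h\xi)(x):=\xi(x-h)$, $h,x\in\mathcal{L}$. A subshift is a nonempty closed set $\Xi\subseteq\mathcal{A}^{\mathcal{L}}$ with $\tau^h\xi\in\Xi$ for all $\xi\in\Xi$, $h\in\mathcal{L}$; $\mathcal{J}$ is the set of all subshifts, with the Hausdorff metric $d^H_{\mathcal{A}^{\mathcal{L}}}$ induced by $d_{\mathcal{A}^{\mathcal{L}}}$. Hamiltonians: $\mathcal{H}=\ell^2(\mathcal{L})\otimes\mathbb{C}^N$; $M_N(\mathbb{C})$ carries the operator norm $\|\cdot\|_{\rm op}$ induced by the Euclidean norm. A finite range Hamiltonian $H=(H_\xi)_{\xi\in\mathcal{A}^{\mathcal{L}}}$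 is a family of bounded self-adjoint operators on $\mathcal{H}$ of the form $$(H_\xi\psi)(x)=\sum_{h\in\mathcal{R}}t_h(\tau^{-x}\xi)\,\psi(x-h),$$ where $\mathcal{R}\subseteq\mathcal{L}$ is finite, $\mathcal{R}=-\mathcal{R}$, each $t_h:\mathcal{A}^{\mathcal{L}}\to M_N(\mathbb{C})$ is continuous, and $t_{-h}(\xi)=t_h(\tau^{-h}\xi)^*$ (adjoint matrix). For finite $\mathcal{A}$, $t:\mathcal{A}^{\mathcal{L}}\to M_N(\mathbb{C})$ is strongly pattern equivariant if there is a radius of influence $1\le R_t<\infty$ such that $t(\xi)=t(\eta)$ whenever $\xi$ and $\eta$ coincide on $Q_{R_t}\cap\mathcal{L}$; $H$ is strongly pattern equivariant if all $t_h$ are. For each such $t$ let $C_t\ge1$ be a constant with $$\|t(\xi)-t(\eta)\|_{\rm op}\le C_t\sup_{y\in Q_{R_t}\cap\mathcal{L}}d_{\mathcal{A}}(\xi(y),\eta(y))\quad\text{for all }\xi,\eta$$ (such a constant exists). Put $R_H:=\sup_{h\in\mathcal{R}}R_{t_h}$, $C_{hop}:=\sup_{h\in\mathcal{R}}C_{t_h}$, and $$\|H\|_1:=\sum_{h\in\mathcal{R}}\|t_h\|_\infty(1+|h|^2)^{1/2},\qquad \|t_h\|_\infty:=\sup_\xi\|t_h(\xi)\|_{\rm op}.$$ Spectra: for $\Xi\in\mathcal{J}$, $\sigma(H_\Xi):=\overline{\bigcup_{\xi\in\Xi}\sigma(H_\xi)}\subseteq\mathbb{R}$; $d_H$ is the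 Hausdorff distance between compact subsets of $\mathbb{R}$. *)

(* Defs.v *)
From HB Require Import structures.
From mathcomp Require Import all_boot all_order all_algebra.
From mathcomp Require Import finmap.
From mathcomp Require Import complex.
From mathcomp Require Import all_classical all_reals all_analysis.
From mathcomp Require Import ring.
From mathcomp Require summability.

Set Implicit Arguments.
Unset Strict Implicit.
Unset Printing Implicit Defensive.

Import Order.TTheory GRing.Theory Num.Theory.
Import numFieldNormedType.Exports.
Import ComplexField.Normc.

Local Open Scope classical_set_scope.
Local Open Scope ring_scope.

Section Lattice.
Context {R : realType} {d : nat}.

Definition lattice_pred (M : 'M[R]_d) : {pred 'cV[R]_d} :=
  fun v => `[< exists k : 'cV[int]_d, v = M *m map_mx intr k >].

Section LatticeType.
Variable M : 'M[R]_d.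

Fact lattice_zmod_closed : zmod_closed (lattice_pred M).
Proof.
split=> [|u v]; rewrite !unfold_in.
  by apply/asboolP; exists 0; rewrite map_mx0 mulmx0.
move=> /asboolP[k ->] /asboolP[l ->]; apply/asboolP; exists (k - l).
by rewrite map_mxB mulmxBr.
Qed.

HB.instance Definition _ :=
  GRing.isZmodClosed.Build _ (lattice_pred M) lattice_zmod_closed.

Record lattice := Lattice {
  lattice_val :> 'cV[R]_d;
  latticeP : lattice_val \in lattice_pred M }.

HB.instance Definition _ := [isSub for lattice_val].
HB.instance Definition _ := [Choice of lattice by <:].
HB.instance Definition _ := [SubChoice_isSubZmodule of lattice by <:].

End LatticeType.

(* [`|x|] on matrices is the maximum norm, not the Euclidean one. *)
Definition euclid (x : 'cV[R]_d) : R := Num.sqrt (\sum_i x i 0 ^+ 2).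

(* [mx_norm x] is the maximum of the absolute values of the entries of [x].
   The box depends on the matrix [M], not only on the lattice it generates. *)
Definition box (M : 'M[R]_d) (r : R) : set 'cV[R]_d :=
  [set M *m x | x in [set x : 'cV[R]_d | mx_norm x <= r]].

End Lattice.

Definition config (R : realType) (d : nat) (M : 'M[R]_d) (A : finType) : Type :=
  lattice M -> A.

HB.instance Definition _ (R : realType) (d : nat) (M : 'M[R]_d) (A : finType) :=
  gen_eqMixin (config M A).
HB.instance Definition _ (R : realType) (d : nat) (M : 'M[R]_d) (A : finType) :=
  gen_choiceMixin (config M A).

Section Config.
Context {R : realType} {d : nat} {M : 'M[R]_d} {A : finType}.
Implicit Types (xi eta zeta : config M A) (r s : R).

Definition alphabet_dist (a b : A) : R := (a != b)%:R.

Definition agree_radii xi eta : set R :=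
  [set r | 0 < r /\
    forall x : lattice M, box M r x ->
      alphabet_dist (xi x) (eta x) <= r^-1].

(* 1 belongs to [agree_radii xi eta], so the convention inf set0 = +oo is
   never used. *)
Definition config_dist xi eta : R :=
  Num.min (inf [set r^-1 | r in agree_radii xi eta]) 1.

Local Notation closes xi eta := [set r^-1 | r in agree_radii xi eta].

Let box_le r s (x : 'cV[R]_d) : r <= s -> box M r x -> box M s x.
Proof. by move=> rs [y /= yr <-]; exists y => //=; exact: le_trans rs. Qed.

Let alphabet_dist_le1 (a b : A) : alphabet_dist a b <= 1 :> R.
Proof. by rewrite /alphabet_dist lern1 leq_b1. Qed.

Let close1 xi eta : agree_radii xi eta 1.
Proof. by split=> // x _; rewrite invr1. Qed.

Let closes_ge0 xi eta : lbound (closes xi eta) 0.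
Proof. by move=> _ [r [/= r0 _] <-]; rewrite invr_ge0 ltW. Qed.

Let has_inf_closes xi eta : has_inf (closes xi eta).
Proof. by split; [exists 1^-1; exists 1 => //=|exists 0]. Qed.

Let dist_le xi eta r : agree_radii xi eta r -> config_dist xi eta <= r^-1.
Proof.
move=> c; rewrite /config_dist ge_min; apply/orP; left.
by apply: ge_inf; [exists 0|exists r].
Qed.

Let dist_lt xi eta (e : R) : config_dist xi eta < e ->
  exists2 r, agree_radii xi eta r & r^-1 < e.
Proof.
rewrite /config_dist gt_min => /orP[|lt1]; last first.
  by exists 1; rewrite ?invr1.
by case/(inf_lt (has_inf_closes xi eta).1) => _ [r c <-] re; exists r.
Qed.

Let config_distxx xi : config_dist xi xi = 0.
Proof.
apply/eqP; rewrite eq_le; apply/andP; split; last first.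
  by rewrite /config_dist le_min ler01 andbT; apply: lb_le_inf => //;
    case: (has_inf_closes xi xi).
apply/ler_addgt0Pl => e e0; rewrite addr0 -[e]invrK; apply: dist_le.
split=> [|x _]; first by rewrite invr_gt0.
by rewrite /alphabet_dist eqxx invrK ltW.
Qed.

Let config_dist_sym xi eta : config_dist xi eta = config_dist eta xi.
Proof.
rewrite /config_dist; congr (Num.min (inf _) 1).
by apply/seteqP; split=> _ [r [/= r0 c] <-]; exists r => //=; split=> // x /c;
  rewrite /alphabet_dist eq_sym.
Qed.

Let config_dist_eq0 xi eta : config_dist xi eta = 0 -> xi = eta.
Proof.
move=> d0; apply/funext => x; apply/eqP; apply: contraT => neq.
have /asboolP[k xk] : lattice_val x \in lattice_pred M := latticeP x.
pose m : R := 1 + mx_norm (map_mx intr k : 'cV[R]_d).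
have m1 : 1 <= m by rewrite lerDl mx_normE.
have m0 : 0 < m by exact: lt_le_trans m1.
have [|r [r0 c] rm] := @dist_lt xi eta m^-1; first by rewrite d0 invr_gt0.
have mr : m < r by rewrite -(ltf_pV2 (x := r) (y := m)) ?posrE.
have /c : box M r x.
  exists (map_mx intr k) => //=; apply: (ltW (le_lt_trans _ mr)).
  by rewrite lerDr.
rewrite /alphabet_dist neq leNgt => /negP[].
by rewrite invf_lt1//; exact: le_lt_trans mr.
Qed.

Let config_dist_triangle eta xi zeta :
  config_dist xi zeta <= config_dist xi eta + config_dist eta zeta.
Proof.
apply/ler_addgt0Pl => e e0.
have e20 : 0 < e / 2 by rewrite divr_gt0.
have [|r [r0 cr] re] := @dist_lt xi eta (config_dist xi eta + e / 2).
  by rewrite ltrDl.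
have [|s [s0 cs] se] := @dist_lt eta zeta (config_dist eta zeta + e / 2).
  by rewrite ltrDl.
have ir0 : 0 < r^-1 by rewrite invr_gt0.
have is0 : 0 < s^-1 by rewrite invr_gt0.
have rs0 : 0 < r^-1 + s^-1 by rewrite addr_gt0.
apply: (@le_trans _ _ (r^-1 + s^-1)); last first.
  by move: (ltW (ltrD re se)); rewrite addrACA -splitr [leRHS]addrC.
rewrite -[r^-1 + s^-1]invrK; apply: dist_le; split; first by rewrite invr_gt0.
move=> x bx; rewrite invrK.
have bxr : box M r x.
  apply: box_le bx; rewrite -[leRHS]invrK lef_pV2 ?posrE//.
  by rewrite lerDl ltW.
have bxs : box M s x.
  apply: box_le bx; rewrite -[leRHS]invrK lef_pV2 ?posrE//.
  by rewrite lerDr ltW.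
apply: le_trans (lerD (cr _ bxr) (cs _ bxs)).
rewrite /alphabet_dist -natrD ler_nat.
have [->|_] := eqVneq (xi x) (eta x); first by rewrite add0n.
by rewrite (leq_trans (leq_b1 _))// leq_addr.
Qed.

HB.instance Definition _ := isMetric.Build R (config M A)
  config_distxx config_dist_eq0 config_dist_sym config_dist_triangle.

Definition shift (h : lattice M) xi : config M A := fun x => xi (x - h).

Definition subshift (Xi : set (config M A)) : Prop :=
  [/\ Xi !=set0, closed Xi & forall xi h, Xi xi -> Xi (shift h xi)].

End Config.

(* Extended-real valued, so that no default value of sup or inf is involved. *)
Definition hausdorff {R : realType} {T : metricType R} (X Y : set T) : \bar R :=
  maxe (ereal_sup [set ereal_inf [set (mdist x y)%:E | y in Y] | x in X])
       (ereal_sup [set ereal_inf [set (mdist x y)%:E | x in X] | y in Y]).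

Section VectorNorms.
Context {R : realType} {N : nat}.

Definition vnorm (v : 'cV[R[i]]_N) : R :=
  Num.sqrt (\sum_i normc (v i 0) ^+ 2).

Definition opnorm (B : 'M[R[i]]_N) : R :=
  sup [set vnorm (B *m v) | v in [set v | vnorm v <= 1]].

Lemma vnorm_sqr v : vnorm v ^+ 2 = \sum_i normc (v i 0) ^+ 2.
Proof. by rewrite sqr_sqrtr// sumr_ge0// => i _; rewrite sqr_ge0. Qed.

Lemma vnorm_sqrZ a v : vnorm (a *: v) ^+ 2 = normc a ^+ 2 * vnorm v ^+ 2.
Proof.
rewrite !vnorm_sqr mulr_sumr; apply: eq_bigr => i _.
by rewrite mxE normcM exprMn.
Qed.

Lemma vnorm_sqrD_le u v :
  vnorm (u + v) ^+ 2 <= 2 * vnorm u ^+ 2 + 2 * vnorm v ^+ 2.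
Proof.
rewrite !vnorm_sqr !mulr_sumr -big_split/=; apply: ler_sum => i _.
rewrite mxE.
have nc0 (z : R[i]) : 0 <= normc z by case: z => a b; exact: sqrtr_ge0.
apply: (@le_trans _ _ ((normc (u i 0) + normc (v i 0)) ^+ 2)).
  by rewrite ler_sqr ?nnegrE ?addr_ge0//; exact: le_normcD.
rewrite -subr_ge0 (_ : _ - _ = (normc (u i 0) - normc (v i 0)) ^+ 2).
  by rewrite sqr_ge0.
by ring.
Qed.

End VectorNorms.

Lemma esumZ_lty {R : realType} {T : choiceType} (c : R) (a : T -> \bar R) :
  0 <= c -> (forall x, 0 <= a x)%E -> (\esum_(x in [set: T]) a x < +oo)%E ->
  (\esum_(x in [set: T]) (c%:E * a x) < +oo)%E.
Proof.
move=> c0 a0 afin.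
apply: (@le_lt_trans _ _ (c%:E * \esum_(x in [set: T]) a x)%E).
  apply: ge_ereal_sup => _ [X [finX _] <-].
  rewrite -ge0_mule_fsumr//; apply: lee_wpmul2l; first by rewrite lee_fin.
  by apply: ereal_sup_ubound; exists X.
by apply: lte_mul_pinfty; rewrite ?lee_fin.
Qed.

Section Ell2.
Context {R : realType} {d : nat}.

Definition ell2_pred (M : 'M[R]_d) (N : nat) :
    {pred (lattice M -> 'cV[R[i]]_N)} :=
  fun psi =>
    `[< (\esum_(x in [set: lattice M]) (vnorm (psi x) ^+ 2)%:E < +oo)%E >].

Arguments ell2_pred : clear implicits.

Section Ell2Type.
Variables (M : 'M[R]_d) (N : nat).

Fact ell2_submod_closed : submod_closed (ell2_pred M N).
Proof.
split=> [|a u v]; rewrite !unfold_in.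
  apply/asboolP; rewrite esum1// => x _.
  by rewrite vnorm_sqr big1// => i _; rewrite mxE normc0 expr0n.
move=> /asboolP us /asboolP vs; apply/asboolP.
pose c : R := 2 * normc a ^+ 2.
have c0 : 0 <= c by rewrite mulr_ge0// sqr_ge0.
apply: (@le_lt_trans _ _ (\esum_(x in [set: lattice M])
    (c%:E * (vnorm (u x) ^+ 2)%:E + 2%:E * (vnorm (v x) ^+ 2)%:E))%E).
  apply: le_esum => x _; rewrite -!EFinM -EFinD lee_fin.
  by apply: le_trans (vnorm_sqrD_le _ _) _; rewrite vnorm_sqrZ mulrA.
rewrite esumD; last 2 first.
- by move=> x _; rewrite mule_ge0// lee_fin sqr_ge0.
- by move=> x _; rewrite mule_ge0// lee_fin sqr_ge0.
apply: lte_add_pinfty; apply: esumZ_lty => // x.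
- by rewrite lee_fin sqr_ge0.
- by rewrite lee_fin sqr_ge0.
Qed.

HB.instance Definition _ :=
  GRing.isSubmodClosed.Build _ _ (ell2_pred M N) ell2_submod_closed.

Record ell2 := Ell2 {
  ell2_val :> lattice M -> 'cV[R[i]]_N;
  ell2P : ell2_val \in ell2_pred M N }.

HB.instance Definition _ := [isSub for ell2_val].
HB.instance Definition _ := [Choice of ell2 by <:].
HB.instance Definition _ := [SubChoice_isSubLmodule of ell2 by <:].

End Ell2Type.
End Ell2.

Arguments ell2_pred {R d} M N.
Arguments ell2 {R d} M N.

Section Operators.
Context {R : realType} {d : nat} {M : 'M[R]_d} {N : nat}.
Local Open Scope sesquilinear_scope.
Local Open Scope complex_scope.

Implicit Types (phi psi : ell2 M N) (T : {linear ell2 M N -> ell2 M N}).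

Definition ell2_inner phi psi : R[i] :=
  summability.sum (fun x => ((phi x)^t* *m psi x) 0 0 : R[i]^o).

Definition ell2_norm psi : R :=
  Num.sqrt (fine (\esum_(x in [set: lattice M]) (vnorm (psi x) ^+ 2)%:E)).

Definition bounded_op T : Prop :=
  exists c : R, forall psi, ell2_norm (T psi) <= c * ell2_norm psi.

Definition self_adjoint T : Prop :=
  forall phi psi, ell2_inner (T phi) psi = ell2_inner phi (T psi).

Definition resolvent_set T : set R[i] :=
  [set z | exists S : {linear ell2 M N -> ell2 M N},
    [/\ bounded_op S,
        forall psi, S (T psi - z *: psi) = psi &
        forall psi, T (S psi) - z *: S psi = psi]].

Definition spectrum T : set R[i] := ~` resolvent_set T.

End Operators.

Record hamiltonian (R : realType) (d : nat) (M : 'M[R]_d) (A : finType)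
    (N : nat) := Hamiltonian {
  hop_range : {fset lattice M};
  (* [hop h] is only constrained for [h] in [hop_range]. *)
  hop : lattice M -> config M A -> 'M[R[i]]_N;
  ham :> config M A -> {linear ell2 M N -> ell2 M N};
  hop_rangeN : forall h, h \in hop_range -> - h \in hop_range;
  hop_continuous : forall h, h \in hop_range ->
    forall xi, opnorm (hop h eta - hop h xi) @[eta --> xi] --> (0 : R);
  hop_adjoint : forall h, h \in hop_range ->
    forall xi, hop (- h) xi = ((hop h (shift (- h) xi))^t*)%sesqui;
  hamE : forall xi psi x,
    ham xi psi x =
      \sum_(h <- hop_range) hop h (shift (- x) xi) *m psi (x - h);
  ham_bounded : forall xi, bounded_op (ham xi);
  ham_self_adjoint : forall xi, self_adjoint (ham xi) }.

Section Hamiltonian.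
Context {R : realType} {d : nat} {M : 'M[R]_d} {A : finType} {N : nat}.
Implicit Types (t : config M A -> 'M[R[i]]_N) (H : hamiltonian M A N).
Local Open Scope complex_scope.

(* [t] is strongly pattern equivariant when it has a radius of influence. *)
Definition influence_radius t (r : R) : Prop :=
  1 <= r /\ forall xi eta : config M A,
    (forall x : lattice M, box M r x -> xi x = eta x) -> t xi = t eta.

Definition hop_constant t (r c : R) : Prop :=
  1 <= c /\ forall xi eta : config M A,
    opnorm (t xi - t eta) <=
      c * sup [set alphabet_dist (xi y) (eta y) |
                y in [set y : lattice M | box M r y]].

Definition supnorm t : R := sup [set opnorm (t xi) | xi in setT].

Definition ham_norm1 H : R :=
  \sum_(h <- hop_range H)
    supnorm (hop H h) * Num.sqrt (1 + euclid (lattice_val h) ^+ 2).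

(* Only the real points are collected: the operators [H xi] are self-adjoint,
   so their spectra are real. *)
Definition ham_spectrum H (Xi : set (config M A)) : set R :=
  closure (\bigcup_(xi in Xi) [set l : R | spectrum (H xi) l%:C]).

End Hamiltonian.

(* Main.v *)
From HB Require Import structures.
Require Import Defs.
From mathcomp Require Import all_boot all_order all_algebra.
From mathcomp Require Import finmap complex.
From mathcomp Require Import all_classical all_reals all_analysis.
From mathcomp Require Import ring lra zify.
From mathcomp Require summability.
Import Order.TTheory GRing.Theory Num.Theory.
Import numFieldNormedType.Exports.
Import ComplexField.Normc.

Set Implicit Arguments.
Unset Strict Implicit.
Unset Printing Implicit Defensive.

Local Open Scope classical_set_scope.
Local Open Scope ring_scope.
Local Open Scope complex_scope.

(** A real point [l] of the spectrum of a bounded self-adjoint operator is one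
    with approximate eigenvectors ([spectrum_approx]); conversely a vector [phi]
    with [|(T - l) phi| <= dl |phi|] forces a point of the spectrum within [dl]
    of [l] ([spectrum_near]). It is therefore enough to turn approximate
    eigenvectors of [H xi], for [xi] in the first subshift, into approximate
    eigenvectors of [H eta] for some [eta] in the second one.

    The operator [H xi] moves vectors by hops only, so multiplication by a cutoff
    which varies on the scale [n] almost commutes with it: the commutator has
    norm at most of order [ham_norm1 H / n], the first moment in [ham_norm1]
    paying for the length of the hops. Averaging over all translates of the
    cutoff shows that some translate, centred at [y] say, cuts an approximate
    eigenvector down to one supported in a box of size [2 * n] around [y], with
    a loss of order [ham_norm1 H / n] only ([localization]). What makes the
    average work is that the boxes of size [n] and [2 * n] contain comparable
    numbers of lattice points ([box_count_doubling]).

    If the subshifts are at distance less than [e], then, after translation by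
    [y], some [eta] in the second subshift coincides with [xi] on the box of
    radius [1 / e] around [y]. Since the coefficients only see the configuration
    up to the radius of influence [r0], the operators [H xi] and [H eta] agree on
    vectors supported in the box of size [2 * n] as soon as
    [2 * n + r0 <= 1 / e] ([ham_local]). For small [r0 * e] one may take [n] of
    order [1 / e], so that the spectral point moves by at most a multiple of
    [ham_norm1 H * e]; for large [r0 * e] the bound [2 * ham_norm1 H] on the norm
    of [H xi - H eta] ([ham_diff_bound]) is at most a multiple of
    [ham_norm1 H * r0 * e]. Both cases are in [spectral_shadowing], and passing
    to closures and to the limit in [e] gives the theorem.

    Of the two facts on spectra, which are stated with the real part [dot] of the
    inner product and the squared norm [sqn], the first comes from the
    completeness of the space by a contraction argument, the second from the
    infimum of the Rayleigh quotients of [(T - l) ^ 2]. *)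

#[local] Existing Instance summability.totally_filter.


(** * Unconditional real sums *)

Section HasSum.
Context {R : realType} {I : choiceType}.
Implicit Types (f g : I -> R) (s t : R).

(** Convergence along the net of finite subsets. Unlike [esum], which serves for
    nonnegative families only, it is linear without sign conditions. *)
Definition has_sum f s :=
  (summability.partial_sum f @ summability.totally --> s)%classic.

Lemma partial_sumE f (X : {fset I}) :
  summability.partial_sum f X = \sum_(i <- X) f i.
Proof. by rewrite /summability.partial_sum big_seq_fsetE. Qed.

Lemma has_sum_uniq f s t : has_sum f s -> has_sum f t -> s = t.
Proof.
by move=> fs ft; apply: (cvg_unique (@norm_hausdorff _ _) fs ft).
Qed.

Lemma has_sumD f g s t :
  has_sum f s -> has_sum g t -> has_sum (fun i => f i + g i) (s + t).
Proof.
move=> fs gt; rewrite /has_sum.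
have -> : summability.partial_sum (fun i => f i + g i) =
    summability.partial_sum f \+ summability.partial_sum g.
  by apply/funext => X; rewrite /= !partial_sumE big_split.
exact: cvgD.
Qed.

Lemma has_sumZ c f s : has_sum f s -> has_sum (fun i => c * f i) (c * s).
Proof.
move=> fs; rewrite /has_sum.
have -> : summability.partial_sum (fun i => c * f i) =
    (fun X => c * summability.partial_sum f X).
  by apply/funext => X; rewrite !partial_sumE mulr_sumr.
by apply: cvgM; [exact: cvg_cst|exact: fs].
Qed.

Lemma esum_ge_fset f (X : {fset I}) : (\sum_(i <- X) (f i)%:E <=
  \esum_(i in [set: I]) (f i)%:E)%E.
Proof.
apply: ereal_sup_ubound; exists [set` X] => /=.
  by split => //; exact: finite_fset.
by rewrite fsbig_finite ?set_fsetK//; exact: finite_fset.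
Qed.

Lemma ge_esum_fset f s : (forall X : {fset I}, \sum_(i <- X) f i <= s) ->
  (\esum_(i in [set: I]) (f i)%:E <= s%:E)%E.
Proof.
move=> fs; apply: ge_ereal_sup => _ [X [finX _] <-].
by rewrite fsbig_finite//= sumEFin lee_fin.
Qed.

(** The finite sums are monotone, so their supremum is their limit along the
    net. *)
Lemma has_sum_esum f : (forall i, 0 <= f i) ->
  (\esum_(i in [set: I]) (f i)%:E < +oo)%E ->
  has_sum f (fine (\esum_(i in [set: I]) (f i)%:E)).
Proof.
move=> f0 foo; set s := fine _.
have sE : (s%:E = \esum_(i in [set: I]) (f i)%:E)%E.
  rewrite fineK// ge0_fin_numE//; apply: esum_ge0 => i _.
  by rewrite lee_fin.
apply/cvgrPdist_le => e e0.
have : (s%:E - e%:E < \esum_(i in [set: I]) (f i)%:E)%E.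
  by rewrite -sE -EFinD lte_fin gtrBl.
move=> /ereal_sup_gt[_ [X [finX _] <-]].
rewrite fsbig_finite// sumEFin -EFinD lte_fin => Xs.
exists (fset_set X) => //= Y XY /=.
rewrite partial_sumE.
have Ys : \sum_(i <- Y) f i <= s.
  by rewrite -lee_fin sE -sumEFin esum_ge_fset.
rewrite ger0_norm ?subr_ge0// lerBlDl -lerBlDr; apply: le_trans (ltW Xs) _.
rewrite [leRHS](big_fsetID _ (mem (fset_set X)))/=.
rewrite (_ : [fset x in Y | x \in fset_set X]%fset = fset_set X).
  by rewrite lerDl sumr_ge0.
apply/fsetP => x; rewrite !inE/= andb_idl//.
by move/fsubsetP : XY => /[apply].
Qed.

End HasSum.

Arguments has_sumZ {R I} c {f s}.
Arguments has_sumD {R I f g s t}.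
Arguments has_sum_uniq {R I f s t}.


(** * The real inner product of square-summable functions *)

Section RealInner.
Context {R : realType} {N : nat}.
Implicit Types u v w : 'cV[R[i]]_N.

(** The real part of the Hermitian inner product. *)
Definition cdot u v : R :=
  \sum_i (complex.Re (u i 0) * complex.Re (v i 0) +
          complex.Im (u i 0) * complex.Im (v i 0)).

Lemma cdotC u v : cdot u v = cdot v u.
Proof. by apply: eq_bigr => i _; ring. Qed.

Lemma cdotDr u v w : cdot u (v + w) = cdot u v + cdot u w.
Proof.
rewrite /cdot -big_split; apply: eq_bigr => i _ /=; rewrite mxE.
by case: (u i 0) (v i 0) (w i 0) => a b [c e] [f g] /=; ring.
Qed.

Lemma cdotZr (c : R) u v : cdot u (c%:C *: v) = c * cdot u v.
Proof.
rewrite /cdot mulr_sumr; apply: eq_bigr => i _ /=; rewrite mxE.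
by case: (u i 0) (v i 0) => a b [e f] /=; ring.
Qed.

Lemma vnorm_sqr_cdot v : vnorm v ^+ 2 = cdot v v.
Proof.
rewrite vnorm_sqr; apply: eq_bigr => i _; case: (v i 0) => a b /=.
by rewrite sqr_sqrtr ?addr_ge0 ?sqr_ge0// !expr2.
Qed.

Lemma vnorm_sqr_lin (c : R) u v : vnorm (u + c%:C *: v) ^+ 2 =
  vnorm u ^+ 2 + 2 * c * cdot u v + c ^+ 2 * vnorm v ^+ 2.
Proof.
rewrite !vnorm_sqr_cdot cdotDr cdotZr ![cdot (_ + _) _]cdotC !cdotDr !cdotZr.
by rewrite (cdotC v u); ring.
Qed.

Lemma polarization u v :
  cdot u v = 4^-1 * (vnorm (u + v) ^+ 2) + (- 4^-1) * (vnorm (u - v) ^+ 2).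
Proof.
have := vnorm_sqr_lin 1 u v; rewrite rmorph1 scale1r.
have := vnorm_sqr_lin (-1) u v; rewrite rmorphN1 scaleN1r.
move: (vnorm (u - v)) (vnorm (u + v)) => x y.
by move: (vnorm u) (vnorm v) (cdot u v) => a b c; lra.
Qed.

Lemma vnorm0 : vnorm (0 : 'cV[R[i]]_N) = 0.
Proof.
by rewrite /vnorm big1 ?sqrtr0// => i _; rewrite mxE normc0 expr0n.
Qed.

Lemma vnorm_ge0 v : 0 <= vnorm v.
Proof. exact: sqrtr_ge0. Qed.

Lemma vnorm_sqr_eq0 v : vnorm v ^+ 2 = 0 -> v = 0.
Proof.
rewrite vnorm_sqr => /eqP; rewrite psumr_eq0 => [/allP v0|i _]; last first.
  exact: sqr_ge0.
apply/matrixP => i j; rewrite ord1 mxE.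
have := v0 i (mem_index_enum _); rewrite sqrf_eq0 => /eqP.
exact: eq0_normc.
Qed.

Lemma conj_mul_cdot u v : ((u^t*)%sesqui *m v) 0 0 =
  (cdot u v)%:C + 'i * (cdot ('i *: u) v)%:C.
Proof.
rewrite !mxE /cdot !rmorph_sum mulr_sumr -big_split; apply: eq_bigr => i _.
rewrite !mxE -[Num.conj _]/(conjc _); case: (u i 0) (v i 0) => a b [c e] /=.
by apply/eqP; rewrite eq_complex /=; apply/andP; split; apply/eqP => /=; ring.
Qed.

End RealInner.

Lemma summability_sumE (I : choiceType) (K : numFieldType) (V : normedModType K)
    (f : I -> V) (l : V) :
  summability.partial_sum f @ summability.totally --> l -> summability.sum f = l.
Proof. by move=> fl; apply: cvg_lim fl; exact: norm_hausdorff. Qed.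

Section Ell2Dot.
Context {R : realType} {d : nat} {M : 'M[R]_d} {N : nat}.
Implicit Types phi psi chi : ell2 M N.

(** The real part of the inner product makes [ell2 M N] a real Hilbert space,
    which is all the spectral theory of a self-adjoint operator at a real point
    of its spectrum needs. *)
Definition dot phi psi : R :=
  lim (summability.partial_sum (fun x => cdot (phi x) (psi x)) @ summability.totally).

Lemma ell2_esum_fin psi :
  (\esum_(x in [set: lattice M]) (vnorm (psi x) ^+ 2)%:E < +oo)%E.
Proof. by have /asboolP := ell2P psi. Qed.

Lemma has_sum_vnorm psi :
  has_sum (fun x => vnorm (psi x) ^+ 2)
    (fine (\esum_(x in [set: lattice M]) (vnorm (psi x) ^+ 2)%:E)).
Proof.
by apply: has_sum_esum => [x|]; [exact: sqr_ge0|exact: ell2_esum_fin].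
Qed.

Arguments has_sum_vnorm : clear implicits.

Lemma ell2D phi psi x : (phi + psi) x = phi x + psi x.
Proof. by []. Qed.

Lemma ell2B phi psi x : (phi - psi) x = phi x - psi x.
Proof. by []. Qed.

Lemma ell2Z a psi x : (a *: psi) x = a *: psi x.
Proof. by []. Qed.

(** By polarization the family is a combination of two summable families of
    squares. *)
Lemma has_sum_dot phi psi :
  has_sum (fun x => cdot (phi x) (psi x)) (dot phi psi).
Proof.
suff : exists s, has_sum (fun x => cdot (phi x) (psi x)) s.
  by case=> s fs; rewrite /dot (cvg_lim (@Rhausdorff R) fs).
have h1 := has_sumZ 4^-1 (has_sum_vnorm (phi + psi)).
have h2 := has_sumZ (- 4^-1) (has_sum_vnorm (phi - psi)).
eexists; have := has_sumD h1 h2.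
congr (has_sum _ _); apply/funext => x.
by rewrite polarization.
Qed.

Arguments has_sum_dot : clear implicits.

Lemma dotC phi psi : dot phi psi = dot psi phi.
Proof.
apply: has_sum_uniq (has_sum_dot psi phi).
by under eq_fun do rewrite cdotC; exact: has_sum_dot.
Qed.

Lemma dotDr phi psi chi : dot phi (psi + chi) = dot phi psi + dot phi chi.
Proof.
apply: (has_sum_uniq (has_sum_dot _ _)).
under eq_fun do rewrite ell2D cdotDr.
by apply: has_sumD; exact: has_sum_dot.
Qed.

Lemma dotZr (c : R) phi psi : dot phi (c%:C *: psi) = c * dot phi psi.
Proof.
apply: (has_sum_uniq (has_sum_dot _ _)).
under eq_fun do rewrite ell2Z cdotZr.
by apply: has_sumZ; exact: has_sum_dot.
Qed.

Lemma dotDl phi psi chi : dot (phi + psi) chi = dot phi chi + dot psi chi.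
Proof. by rewrite dotC dotDr !(dotC chi). Qed.

Lemma dotZl (c : R) phi psi : dot (c%:C *: phi) psi = c * dot phi psi.
Proof. by rewrite dotC dotZr (dotC phi). Qed.

Lemma dotNr phi psi : dot phi (- psi) = - dot phi psi.
Proof. by rewrite -scaleN1r -(rmorphN1 (real_complex R)) dotZr mulN1r. Qed.

Lemma dotNl phi psi : dot (- phi) psi = - dot phi psi.
Proof. by rewrite dotC dotNr dotC. Qed.

Definition sqn psi : R := dot psi psi.

Lemma sqnE psi :
  ((sqn psi)%:E = \esum_(x in [set: lattice M]) (vnorm (psi x) ^+ 2)%:E)%E.
Proof.
have -> : sqn psi = fine (\esum_(x in [set: lattice M]) (vnorm (psi x) ^+ 2)%:E).
  apply: (has_sum_uniq (has_sum_dot _ _)).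
  under eq_fun do rewrite -vnorm_sqr_cdot.
  exact: has_sum_vnorm.
rewrite fineK// ge0_fin_numE ?ell2_esum_fin//; apply: esum_ge0 => x _.
by rewrite lee_fin sqr_ge0.
Qed.

Lemma sqn_ge0 psi : 0 <= sqn psi.
Proof.
by rewrite -lee_fin sqnE; apply: esum_ge0 => x _; rewrite lee_fin sqr_ge0.
Qed.

Lemma ell2_norm_sqr psi : ell2_norm psi ^+ 2 = sqn psi.
Proof. by rewrite /ell2_norm -sqnE /= sqr_sqrtr// sqn_ge0. Qed.

Lemma sqn_sum_le psi (X : {fset lattice M}) :
  \sum_(x <- X) vnorm (psi x) ^+ 2 <= sqn psi.
Proof. by rewrite -lee_fin sqnE -sumEFin esum_ge_fset. Qed.

Lemma sqn_pt_le psi x : vnorm (psi x) ^+ 2 <= sqn psi.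
Proof. by have := sqn_sum_le psi [fset x]%fset; rewrite big_seq_fset1. Qed.

Lemma sqn_eq0 psi : sqn psi = 0 -> psi = 0.
Proof.
move=> psi0; apply: val_inj; apply/funext => x; apply: vnorm_sqr_eq0.
by apply/eqP; rewrite eq_le sqr_ge0 andbT -psi0 sqn_pt_le.
Qed.

Lemma sqnD phi psi : sqn (phi + psi) = sqn phi + 2 * dot phi psi + sqn psi.
Proof. by rewrite /sqn dotDl !dotDr (dotC psi phi); ring. Qed.

Lemma sqnZ (c : R) psi : sqn (c%:C *: psi) = c ^+ 2 * sqn psi.
Proof. by rewrite /sqn dotZl dotZr; ring. Qed.

Lemma sqnN psi : sqn (- psi) = sqn psi.
Proof. by rewrite /sqn dotNl dotNr opprK. Qed.

Lemma sqnB phi psi : sqn (phi - psi) = sqn phi - 2 * dot phi psi + sqn psi.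
Proof. by rewrite sqnD sqnN dotNr; ring. Qed.

Lemma sqn0 : sqn 0 = 0.
Proof. by rewrite -(scale0r (0 : ell2 M N)) -(rmorph0 (real_complex R)) sqnZ; ring. Qed.

Lemma sqnD_young (a : R) phi psi : 0 < a ->
  sqn (phi + psi) <= (1 + a) * sqn phi + (1 + a^-1) * sqn psi.
Proof.
move=> a0; have := sqn_ge0 (a%:C *: phi - psi).
rewrite sqnB sqnZ dotZl => h.
have h2 : 2 * dot phi psi <= a * sqn phi + a^-1 * sqn psi.
  rewrite -(ler_pM2l a0) mulrDr !mulrA mulfV ?gt_eqF// mul1r -subr_ge0.
  by apply: le_trans h _; rewrite le_eqVlt; apply/orP; left; apply/eqP; ring.
by rewrite sqnD; lra.
Qed.

Lemma sqnD_le phi psi : sqn (phi + psi) <= 2 * sqn phi + 2 * sqn psi.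
Proof. by have := sqnD_young phi psi ltr01; rewrite invr1. Qed.

Lemma sqnB_le phi psi : sqn (phi - psi) <= 2 * sqn phi + 2 * sqn psi.
Proof. by rewrite -(sqnN psi); exact: sqnD_le. Qed.

(** The bridge from the complex hypothesis of self-adjointness to the symmetry
    of the operator for [dot]. *)
Lemma ell2_inner_dot phi psi :
  ell2_inner phi psi = (dot phi psi)%:C + 'i * (dot ('i *: phi) psi)%:C.
Proof.
rewrite /ell2_inner; apply: (@summability_sumE _ R[i] R[i]^o).
have h1 := has_sum_dot phi psi.
have h2 := has_sum_dot ('i *: phi) psi.
set a := dot phi psi in h1 *; set b := dot _ psi in h2 *.
apply/cvgrPdist_le => e e0.
have [r r0 ->] : exists2 r : R, 0 < r & e = r%:C.
  move: e0; case: e => r i; rewrite ltcE /= => /andP[/eqP -> r0].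
  by exists r.
have r20 : 0 < r / 2 by rewrite divr_gt0.
move/cvgrPdist_le : h1 => /(_ _ r20) h1.
move/cvgrPdist_le : h2 => /(_ _ r20) h2.
near=> X.
have k1 : `|a - summability.partial_sum (fun x => cdot (phi x) (psi x)) X| <= r / 2.
  by near: X; exact: h1.
have k2 : `|b - summability.partial_sum (fun x => cdot (('i *: phi) x) (psi x)) X| <= r / 2.
  by near: X; exact: h2.
rewrite /summability.partial_sum (eq_bigr _ (fun x _ => conj_mul_cdot _ _)).
rewrite big_split/= -mulr_sumr -!rmorph_sum/=.
rewrite opprD addrACA -mulrBr -!rmorphB/=.
apply: le_trans (ler_normD _ _) _.
rewrite normrM.
have -> : `|'i : R[i]| = 1.
  by rewrite normc_def /= expr0n add0r expr1n sqrtr1.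
have nR (x : R) : `|x%:C| = `|x|%:C.
  by rewrite normc_def /= expr0n addr0 sqrtr_sqr.
rewrite mul1r !nR -rmorphD lecR.
by have := lerD k1 k2; rewrite -splitr.
Unshelve. all: by end_near.
Qed.

End Ell2Dot.

Opaque dot.

(** * Completeness *)

Section Completeness.

Lemma real_cauchy_cvg (R : realType) (a : nat -> R) :
  (forall e, 0 < e -> exists K, forall m k, (K <= m)%N -> (K <= k)%N ->
     `|a m - a k| <= e) -> a x @[x --> \oo] --> limn a.
Proof.
move=> ca; suff : cvgn a by [].
apply/cauchy_cvgP; apply: cauchy_exP => e e0.
have [K cK] := ca (e / 2) (divr_gt0 e0 (ltr0Sn R 1)).
exists (a K); exists K => // m Km.
apply: le_lt_trans (cK _ _ (leqnn K) Km) _.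
by rewrite ltr_pdivrMr// mulr_natr mulr2n ltrDl.
Qed.

Context {R : realType} {d : nat} {M : 'M[R]_d} {N : nat}.
Implicit Types phi psi : ell2 M N.

Lemma re_im_sqr_le_vnorm (v : 'cV[R[i]]_N) i :
  complex.Re (v i 0) ^+ 2 <= vnorm v ^+ 2 /\
  complex.Im (v i 0) ^+ 2 <= vnorm v ^+ 2.
Proof.
rewrite vnorm_sqr_cdot /cdot (bigD1 i)//= -!expr2.
set s := \sum_(_ | _) _; have s0 : 0 <= s.
  by apply: sumr_ge0 => j _; rewrite -!expr2 addr_ge0// sqr_ge0.
have := sqr_ge0 (complex.Re (v i 0)); have := sqr_ge0 (complex.Im (v i 0)).
by split; lra.
Qed.

(** Pointwise limits exist because the entries are Cauchy, and on every finite
    set of sites the Cauchy bound passes to the limit, hence to the full sum. *)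
Lemma ell2_complete (u : nat -> ell2 M N) :
  (forall e, 0 < e -> exists K, forall m k, (K <= m)%N -> (K <= k)%N ->
     sqn (u m - u k) <= e) ->
  exists U, forall e, 0 < e -> exists K, forall k, (K <= k)%N ->
     sqn (u k - U) <= e.
Proof.
move=> cu.
pose a x i m := complex.Re (u m x i 0); pose b x i m := complex.Im (u m x i 0).
have sq_le (s e : R) : 0 < e -> s ^+ 2 <= e ^+ 2 -> `|s| <= e.
  by move=> e0 h; rewrite -ler_sqr ?nnegrE ?(ltW e0)// real_normK// num_real.
have ReB (z w : R[i]) : complex.Re (z - w) = complex.Re z - complex.Re w.
  by case: z w => z1 z2 [w1 w2].
have ImB (z w : R[i]) : complex.Im (z - w) = complex.Im z - complex.Im w.
  by case: z w => z1 z2 [w1 w2].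
have ca x i : a x i m @[m --> \oo] --> limn (a x i).
  apply: real_cauchy_cvg => e e0.
  have [K cK] := cu _ (exprn_gt0 2 e0); exists K => m k Km Kk.
  apply: sq_le => //; apply: le_trans (cK _ _ Km Kk).
  apply: le_trans (sqn_pt_le _ x); rewrite ell2B.
  by have [+ _] := re_im_sqr_le_vnorm (u m x - u k x) i; rewrite !mxE ReB.
have cb x i : b x i m @[m --> \oo] --> limn (b x i).
  apply: real_cauchy_cvg => e e0.
  have [K cK] := cu _ (exprn_gt0 2 e0); exists K => m k Km Kk.
  apply: sq_le => //; apply: le_trans (cK _ _ Km Kk).
  apply: le_trans (sqn_pt_le _ x); rewrite ell2B.
  by have [_ +] := re_im_sqr_le_vnorm (u m x - u k x) i; rewrite !mxE ImB.
pose Uf (x : lattice M) : 'cV[R[i]]_N :=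
  \col_i (limn (a x i) +i* limn (b x i)).
have cuU x k : vnorm (u k x - u m x) ^+ 2 @[m --> \oo] --> vnorm (u k x - Uf x) ^+ 2.
  rewrite vnorm_sqr_cdot.
  under eq_fun do rewrite vnorm_sqr_cdot.
  rewrite /cdot; apply: cvg_big => [|i _].
    exact: add_continuous.
  rewrite !mxE ReB ImB /=.
  under eq_fun do rewrite !mxE ReB ImB.
  have h1 : complex.Re (u k x i 0) - a x i m @[m --> \oo] -->
            complex.Re (u k x i 0) - limn (a x i).
    by apply: cvgB; [exact: cvg_cst|exact: ca].
  have h2 : complex.Im (u k x i 0) - b x i m @[m --> \oo] -->
            complex.Im (u k x i 0) - limn (b x i).
    by apply: cvgB; [exact: cvg_cst|exact: cb].
  by apply: cvgD; apply: cvgM.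
have fatou e K : (forall m k, (K <= m)%N -> (K <= k)%N ->
     sqn (u m - u k) <= e) -> forall k, (K <= k)%N ->
    (\esum_(x in [set: lattice M]) (vnorm (u k x - Uf x) ^+ 2)%:E <= e%:E)%E.
  move=> cK k Kk; apply: ge_esum_fset => X.
  have h : (\sum_(x <- X) vnorm (u k x - u m x) ^+ 2) @[m --> \oo] -->
      \sum_(x <- X) vnorm (u k x - Uf x) ^+ 2.
    by apply: cvg_big => [|x _]; [exact: add_continuous|exact: cuU].
  apply: (ler_cvg_to h (cvg_cst e)); exists K => // m Km /=.
  apply: le_trans (cK _ _ Kk Km).
  exact: (sqn_sum_le (u k - u m)).
have [K cK] := cu 1 ltr01.
have wP : (fun x => u K x - Uf x) \in ell2_pred M N.
  rewrite unfold_in; apply/asboolP.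
  exact: le_lt_trans (fatou _ _ cK _ (leqnn K)) (ltry _).
exists (u K - Ell2 wP) => e e0.
have [K' cK'] := cu e e0; exists K' => k Kk.
rewrite -lee_fin sqnE.
under eq_esum do rewrite !ell2B /= subKr.
exact: fatou cK' _ Kk.
Qed.

End Completeness.

(** * Real spectrum of bounded self-adjoint operators *)

Lemma factor_difference_of_squares (K : comPzRingType) (V : lmodType K)
    (l r : K) (a b v : V) :
  a - (l - r) *: b - (l + r) *: (b - (l - r) *: v) =
  a - l *: b - l *: (b - l *: v) - r ^+ 2 *: v.
Proof.
rewrite !scalerBr !scalerA -!addrA; congr (a + _).
have -> : (l + r) * (l - r) = l * l - r ^+ 2 by ring.
have : (l - r) *: b + (l + r) *: b = l *: b + l *: b.
  by rewrite -!scalerDl; congr (_ *: _); ring.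
rewrite [(l * l - _) *: v]scalerBl.
move: ((l - r) *: b) ((l + r) *: b) (l *: b) => p q x pq.
move: ((l * l) *: v) (r ^+ 2 *: v) => y z.
have -> : - p - (q - (y - z)) = (y - z) - (p + q) by rewrite opprB addrCA opprD.
by rewrite pq opprB [y - x - z]addrAC [RHS]addrCA opprD.
Qed.

Section Spectral.
Context {R : realType} {d : nat} {M : 'M[R]_d} {N : nat}.
Implicit Types (phi psi v w : ell2 M N) (S T q : {linear ell2 M N -> ell2 M N}).

Lemma bounded_op_sqn T : bounded_op T ->
  exists2 L, 0 < L & forall v, sqn (T v) <= L * sqn v.
Proof.
case=> c Tc; exists (c ^+ 2 + 1) => [|v]; first by rewrite ltr_wpDl// sqr_ge0.
have : sqn (T v) <= c ^+ 2 * sqn v.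
  rewrite -!ell2_norm_sqr -exprMn ler_sqr ?nnegrE//.
    exact: sqrtr_ge0.
  exact: le_trans (sqrtr_ge0 _) (Tc v).
by have := sqn_ge0 v; lra.
Qed.

Lemma sqn_bounded_op T L : 0 <= L -> (forall v, sqn (T v) <= L * sqn v) ->
  bounded_op T.
Proof.
move=> L0 TL; exists (Num.sqrt L) => v.
rewrite -ler_sqr ?nnegrE ?mulr_ge0 ?sqrtr_ge0//.
by rewrite exprMn (sqr_sqrtr L0) !ell2_norm_sqr.
Qed.

(** Banach's fixed point theorem for an affine map; the iterates are bounded
    because [(1 + a) * theta < 1] for the chosen [a]. *)
Lemma contraction_fixpoint q theta phi : 0 <= theta -> theta < 1 ->
  (forall v, sqn (q v) <= theta * sqn v) -> exists v, v = q v + phi.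
Proof.
move=> t0 t1 qt.
have [x [x0 xS]] : exists x : nat -> ell2 M N,
    x 0%N = 0 /\ forall n, x n.+1 = q (x n) + phi.
  by exists (fun n => iter n (fun v => q v + phi) 0).
pose a := (1 - theta) / 2.
have a0 : 0 < a by rewrite /a; lra.
have at1 : 0 < 1 - (1 + a) * theta.
  by have : 0 < (1 - theta) * (1 - theta / 2) by [apply: mulr_gt0; lra];
    rewrite /a; lra.
pose B := (1 + a^-1) * sqn phi / (1 - (1 + a) * theta).
have aphi0 : 0 <= (1 + a^-1) * sqn phi.
  by rewrite mulr_ge0 ?sqn_ge0// addr_ge0// invr_ge0 ltW.
have B0 : 0 <= B by rewrite divr_ge0// ltW.
have BE : B * (1 - (1 + a) * theta) = (1 + a^-1) * sqn phi.
  by rewrite /B divfK// gt_eqF.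
have xB n : sqn (x n) <= B.
  elim: n => [|n IH]; first by rewrite x0 sqn0.
  rewrite xS.
  apply: le_trans (sqnD_young _ _ a0) _.
  apply: (@le_trans _ _ ((1 + a) * (theta * B) + (1 + a^-1) * sqn phi)).
    rewrite lerD2r ler_pM2l ?addr_gt0//.
    by apply: le_trans (qt _) _; exact: ler_wpM2l.
  by rewrite -BE; lra.
have xq k m : sqn (x (m + k)%N - x k) <= theta ^+ k * B.
  elim: k => [|k IH]; first by rewrite addn0 x0 subr0 mul1r.
  rewrite addnS !xS opprD addrACA subrr addr0 -linearB.
  by apply: le_trans (qt _) _; rewrite exprS -mulrA; exact: ler_wpM2l.
have xq' k m : (k <= m)%N -> sqn (x m - x k) <= theta ^+ k * B.
  by move=> km; rewrite -(subnK km); exact: xq.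
have small e : 0 < e -> exists K, theta ^+ K * B <= e.
  move=> e0.
  have : theta ^+ n * B @[n --> \oo] --> 0 * B.
    by apply: cvgM; [apply: cvg_expr; rewrite ger0_norm|exact: cvg_cst].
  rewrite mul0r => /cvgr_le /(_ _ e0)[K _ /(_ K (leqnn K))]; by exists K.
have [|U xU] := @ell2_complete _ _ _ _ x.
  move=> e e0; have [K Ke] := small (e / 4) (divr_gt0 e0 (ltr0Sn R 3)).
  exists K => m k Km Kk.
  have -> : x m - x k = (x m - x K) - (x k - x K) by rewrite opprB addrA subrK.
  apply: le_trans (sqnB_le _ _) _.
  have h1 := xq' _ _ Km; have h2 := xq' _ _ Kk.
  move: Ke h1 h2; move: (sqn _) (sqn _) (_ * B).
  by move=> s1 s2 s3 h1 h2 h3; clear -h1 h2 h3; lra.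
exists U; apply/eqP; rewrite -subr_eq0; apply/eqP/sqn_eq0.
apply/eqP; rewrite eq_le sqn_ge0 andbT; apply/ler_addgt0Pl => e e0; rewrite addr0.
have [K xK] := xU (e / 4) (divr_gt0 e0 (ltr0Sn R 3)).
have -> : U - (q U + phi) = q (x K - U) - (x K.+1 - U).
  rewrite xS linearB opprB [RHS]addrCA; congr (_ + _).
  by rewrite !opprD [RHS]addrACA subrr add0r.
apply: le_trans (sqnB_le _ _) _.
have h1 := xK _ (leqnn K); have h2 := xK _ (leqnSn K).
have h3 : sqn (q (x K - U)) <= sqn (x K - U).
  apply: le_trans (qt _) _; rewrite -[leRHS]mul1r.
  by rewrite ler_wpM2r ?sqn_ge0// ltW.
move: h1 h2 h3; move: (sqn _) (sqn (q _)) (sqn _) => s1 s2 s3 h1 h2 h3.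
by clear -h1 h2 h3; lra.
Qed.

Definition dot_symmetric T := forall v w, dot (T v) w = dot v (T w).

(** For [L] at least the square of the norm of [S], the operator
    [1 - S ^ 2 / L] is a contraction as soon as [S] is bounded below, so that
    [S ^ 2], and a fortiori [S], is onto. *)
Lemma bounded_below_onto S c : dot_symmetric S -> bounded_op S -> 0 < c ->
  (forall v, c * sqn v <= sqn (S v)) -> forall phi, exists v, S v = phi.
Proof.
move=> symS /bounded_op_sqn[L0 L00 SL0] c0 Sc phi.
pose L := L0 + c; have L_gt0 : 0 < L by rewrite addr_gt0.
have SL v : sqn (S v) <= L * sqn v.
  by apply: le_trans (SL0 v) _; rewrite /L; have := sqn_ge0 v; nra.
pose q : {linear ell2 M N -> ell2 M N} :=
  idfun \- ((L^-1)%:C \*: (S \o S)).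
have qE v : q v = v - (L^-1)%:C *: S (S v) by [].
have [||v|v vE] := @contraction_fixpoint q (L0 / L) ((L^-1)%:C *: phi).
- by rewrite divr_ge0// ltW.
- by rewrite ltr_pdivrMr// mul1r ltrDl.
- rewrite qE sqnB sqnZ dotZr -symS -/(sqn _).
  have h1 := SL (S v); have h2 := Sc v.
  have i0 : 0 < L^-1 by rewrite invr_gt0.
  have iL : L^-1 * L = 1 by rewrite mulVf// gt_eqF.
  have h3 : L^-1 ^+ 2 * sqn (S (S v)) <= L^-1 * sqn (S v).
    rewrite expr2 -mulrA ler_pM2l// -[leRHS]mul1r -iL -mulrA.
    by rewrite ler_pM2l.
  have h4 : L^-1 * (c * sqn v) <= L^-1 * sqn (S v) by rewrite ler_pM2l.
  have h5 : L0 / L * sqn v = sqn v - L^-1 * (c * sqn v).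
    have -> : L0 = L - c by rewrite /L addrK.
    by rewrite mulrBl mulfV ?gt_eqF//; ring.
  by rewrite h5; lra.
- exists (S v); move: vE; rewrite qE -addrA => /eqP.
  rewrite -subr_eq0 opprD addrA subrr sub0r oppr_eq0 addrC subr_eq0.
  rewrite -subr_eq0 -scalerBr scaler_eq0 => /orP[|].
    by rewrite -(rmorph0 (real_complex R)) (inj_eq (@complexI R)) invr_eq0 gt_eqF.
  by rewrite subr_eq0 => /eqP <-.
Qed.

Definition translate T (l : R) : {linear ell2 M N -> ell2 M N} :=
  T \- (l%:C \*: idfun).

Lemma translateE T l v : translate T l v = T v - l%:C *: v.
Proof. by []. Qed.

Lemma translate_symmetric T l : dot_symmetric T -> dot_symmetric (translate T l).
Proof.
by move=> symT v w; rewrite !translateE dotDl dotDr dotNl dotNr dotZl dotZr symT.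
Qed.

Lemma translate_bounded T l : bounded_op T -> bounded_op (translate T l).
Proof.
move=> /bounded_op_sqn[L L0 TL].
apply: (@sqn_bounded_op _ (2 * L + 2 * l ^+ 2)) => [|v].
  by apply: addr_ge0; apply: mulr_ge0 => //; [exact: ltW|exact: sqr_ge0].
rewrite translateE; apply: le_trans (sqnB_le _ _) _; rewrite sqnZ.
by have := TL v; lra.
Qed.

Lemma self_adjoint_symmetric T : self_adjoint T -> dot_symmetric T.
Proof.
move=> saT v w; have := saT v w; rewrite !ell2_inner_dot.
have ReE (x y : R) : complex.Re (x%:C + 'i * y%:C) = x by rewrite /=; ring.
by move/(congr1 (@complex.Re R)); rewrite !ReE.
Qed.

Lemma bounded_below_resolvent T l c : dot_symmetric T -> bounded_op T -> 0 < c ->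
  (forall v, c * sqn v <= sqn (T v - l%:C *: v)) -> resolvent_set T l%:C.
Proof.
move=> symT bT c0 Tc; pose S := translate T l.
have onto := @bounded_below_onto S c (translate_symmetric l symT)
  (translate_bounded l bT) c0 Tc.
pose g v := projT1 (cid (onto v)).
have gK v : S (g v) = v by rewrite /g; case: cid.
have S0 v : S v = 0 -> v = 0.
  move=> Sv0; apply: sqn_eq0; apply/eqP; rewrite eq_le sqn_ge0 andbT.
  rewrite -(ler_pM2l c0) mulr0; apply: le_trans (Tc v) _.
  by rewrite -translateE -/S Sv0 sqn0.
have Sinj : injective S.
  move=> v w /eqP; rewrite -subr_eq0 -linearB => /eqP/S0/eqP.
  by rewrite subr_eq0 => /eqP.
have glin : linear g.
  by move=> a v w; apply: Sinj; rewrite linearP !gK.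
pose G : {linear ell2 M N -> ell2 M N} :=
  HB.pack g (GRing.isLinear.Build _ _ _ _ g glin).
exists G; split.
- apply: (@sqn_bounded_op _ c^-1) => [|v]; first by rewrite invr_ge0 ltW.
  by rewrite -(ler_pM2l c0) mulrA mulfV ?gt_eqF// mul1r -{2}(gK v); exact: Tc.
- by move=> v; apply: Sinj; rewrite gK.
- by move=> v; exact: gK.
Qed.

(** Weyl's criterion: a point where [T - l] is bounded below is in the
    resolvent set, because a symmetric operator bounded below is invertible. *)
Lemma spectrum_approx T (l e : R) : dot_symmetric T -> bounded_op T ->
  spectrum T l%:C -> 0 < e ->
  exists2 v, 0 < sqn v & sqn (T v - l%:C *: v) <= e * sqn v.
Proof.
move=> symT bT specl e0; apply: contrapT => noex; apply: specl.
apply: (bounded_below_resolvent symT bT e0) => v.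
have [v0|v0] := eqVneq (sqn v) 0; first by rewrite v0 mulr0 sqn_ge0.
rewrite leNgt; apply/negP => /ltW le_e; apply: noex; exists v => //.
by rewrite lt_neqAle eq_sym v0 sqn_ge0.
Qed.

Lemma resolvent_bounded_below T l : resolvent_set T l%:C ->
  exists2 c, 0 < c & forall v, sqn v <= c * sqn (translate T l v).
Proof.
move=> [G [/bounded_op_sqn[c c0 Gc] GK _]]; exists c => // v.
by rewrite -{1}(GK v); exact: Gc.
Qed.

(** The form [sqn (S v) - m * sqn v] is nonnegative; evaluating it at
    [v - (S ^ 2 - m) v / L] gives this Cauchy-Schwarz type bound. *)
Lemma nonneg_form_bound S L m : dot_symmetric S -> 0 < L -> 0 <= m ->
  (forall v, sqn (S v) <= L * sqn v) -> (forall v, m * sqn v <= sqn (S v)) ->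
  forall v, sqn (S (S v) - m%:C *: v) <= L * (sqn (S v) - m * sqn v).
Proof.
move=> symS L0 m0 SL Sm v; set A := _ - _.
have AE : dot (S (S v)) A = sqn A + m * dot v A.
  by rewrite /sqn {2}/A dotDl dotNl dotZl subrK.
clearbody A; have := Sm (v - (L^-1)%:C *: A).
have -> : S (v - (L^-1)%:C *: A) = S v - (L^-1)%:C *: S A.
  by rewrite linearB linearZ.
rewrite !sqnB !sqnZ !dotZr -(symS (S v)) AE.
have := SL A; set s := L^-1.
have s0 : 0 < s by rewrite invr_gt0.
have sL : s * L = 1 by rewrite mulVf// gt_eqF.
have LE x : x = L * (s * x) by rewrite mulrA (mulrC L) sL mul1r.
move=> SA.
have h : s ^+ 2 * sqn (S A) <= s * sqn A.
  by rewrite expr2 -mulrA ler_pM2l// -[leRHS]mul1r -sL -mulrA ler_pM2l.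
have h' : 0 <= m * (s ^+ 2 * sqn A).
  by apply: mulr_ge0 => //; apply: mulr_ge0; [exact: sqr_ge0|exact: sqn_ge0].
move=> hh; rewrite [leLHS]LE ler_pM2l//; move: h h' hh.
move: (sqn A) (sqn (S A)) (sqn v) (sqn (S v)) (dot v A) => a b e f g h h' hh.
by clear -h h' hh; lra.
Qed.

(** With [m] the infimum of the Rayleigh quotients of [(T - l) ^ 2], the
    operator [(T - l) ^ 2 - m] is not bounded below, hence one of its two
    factors [T - (l + sqrt m)] and [T - (l - sqrt m)] is not; and [sqrt m] is at
    most [dl] since [psi] competes in the infimum. *)
Lemma spectrum_near T (l dl : R) psi : dot_symmetric T -> bounded_op T ->
  0 <= dl -> 0 < sqn psi -> sqn (T psi - l%:C *: psi) <= dl ^+ 2 * sqn psi ->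
  exists2 mu : R, spectrum T mu%:C & `|l - mu| <= dl.
Proof.
move=> symT bT dl0 psi0 Tpsi; pose S := translate T l.
have symS : dot_symmetric S := translate_symmetric l symT.
have [L L0 SL] := bounded_op_sqn (translate_bounded l bT).
pose E := [set sqn (S v) / sqn v | v in [set v | 0 < sqn v]].
have E0 : lbound E 0.
  by move=> _ [v /= v0 <-]; rewrite divr_ge0// ?sqn_ge0// ltW.
have Einf : has_inf E by split; [exists (sqn (S psi) / sqn psi); exists psi|exists 0].
pose m := inf E.
have m0 : 0 <= m by apply: lb_le_inf => //; exact: Einf.1.
have Sm v : m * sqn v <= sqn (S v).
  have := sqn_ge0 v; rewrite le_eqVlt => /orP[/eqP <-|v0].
    by rewrite mulr0 sqn_ge0.
  rewrite -ler_pdivlMr//; apply: ge_inf; first exact: Einf.2.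
  by exists v.
have mdl : Num.sqrt m <= dl.
  rewrite -(ger0_norm dl0) -sqrtr_sqr; apply: ler_wsqrtr.
  by rewrite -(ler_pM2r psi0); apply: le_trans (Sm psi) _.
apply: contrapT => noex.
set r := Num.sqrt m in mdl; have r0 : 0 <= r by exact: sqrtr_ge0.
have rr : r ^+ 2 = m by rewrite sqr_sqrtr.
have resP : resolvent_set T (l + r)%:C.
  apply: contrapT => spec; apply: noex; exists (l + r) => //.
  by rewrite opprD addrA subrr sub0r normrN ger0_norm.
have resN : resolvent_set T (l - r)%:C.
  apply: contrapT => spec; apply: noex; exists (l - r) => //.
  by rewrite opprB addrC subrK ger0_norm.
have [c c0 cP] := resolvent_bounded_below resP.
have [c' c'0 cN] := resolvent_bounded_below resN.
have fact v : translate T (l + r) (translate T (l - r) v) = S (S v) - m%:C *: v.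
  have TE a b w : T (w - a%:C *: b) = T w - a%:C *: T b.
    by rewrite linearB linearZ.
  rewrite !translateE !TE -rr.
  have -> : (r ^+ 2)%:C = r%:C ^+ 2 by exact: (rmorphXn (real_complex R)).
  have -> : (l + r)%:C = l%:C + r%:C by exact: (rmorphD (real_complex R)).
  have -> : (l - r)%:C = l%:C - r%:C by exact: (rmorphB (real_complex R)).
  exact: factor_difference_of_squares.
have cc : 0 < c * c' * L by rewrite !mulr_gt0.
have cci : 0 < (c * c' * L)^-1 by rewrite invr_gt0.
have [_ [v /= v0 <-]] : exists2 t, E t & t < m + (c * c' * L)^-1.
  by apply: inf_lt; [exact: Einf.1|rewrite ltrDl].
rewrite ltr_pdivrMr// mulrDl -ltrBlDl => vm.
have : c * c' * L * (sqn (S v) - m * sqn v) < sqn v.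
  by rewrite -ltr_pdivlMl.
apply/negP; rewrite -leNgt.
apply: le_trans (cN v) _; rewrite (mulrC c) -!mulrA ler_pM2l//.
apply: le_trans (cP _) _; rewrite ler_pM2l// fact.
exact: nonneg_form_bound.
Qed.

End Spectral.

(** * Cutoff functions on the lattice *)

Section Translation.
Context {R : realType} {L : choiceType}.

Lemma esum_reindex_inj (e e' : L -> L) (f : L -> \bar R) :
  cancel e e' -> cancel e' e ->
  (\esum_(y in [set: L]) f (e y) = \esum_(y in [set: L]) f y)%E.
Proof.
move=> ee' e'e; rewrite [RHS](@reindex_esum _ _ _ setT setT e)//.
split=> //; first by move=> x y _ _; exact: (can_inj ee').
by move=> y _; exists (e' y).
Qed.

Lemma esumZ (c : R) (f : L -> R) : 0 <= c -> (forall y, 0 <= f y) ->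
  (\esum_(y in [set: L]) (c * f y)%:E = c%:E * \esum_(y in [set: L]) (f y)%:E)%E.
Proof.
move=> c0 f0; have le (a : R) (g : L -> R) : 0 <= a -> (forall y, 0 <= g y) ->
  (\esum_(y in [set: L]) (a * g y)%:E <= a%:E * \esum_(y in [set: L]) (g y)%:E)%E.
  move=> a0 g0; apply: ge_ereal_sup => _ [X [finX _] <-].
  rewrite fsbig_finite//=; under eq_bigr do rewrite EFinM.
  rewrite -ge0_sume_distrr => [|y _]; last by rewrite lee_fin.
  apply: lee_wpmul2l; first by rewrite lee_fin.
  by apply: ereal_sup_ubound; exists X; [split|rewrite fsbig_finite].
apply/eqP; rewrite eq_le le//=.
have [->|cn0] := eqVneq c 0.
  by rewrite mul0e; apply: esum_ge0 => y _; rewrite mul0r.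
have cp : 0 < c by rewrite lt_neqAle eq_sym cn0.
rewrite -lee_pdivlMl//; apply: le_trans (le c^-1 _ _ _).
- by apply: le_esum => y _; rewrite mulrA mulVf// mul1r.
- by rewrite invr_ge0.
- by move=> y; rewrite mulr_ge0.
Qed.

End Translation.

Section Gauge.
Context {R : realType} {d : nat} (M : 'M[R]_d).
Implicit Types x y : 'cV[R]_d.

(** The norm whose closed balls are the boxes [box M r]. *)
Definition gauge x : R := mx_norm (invmx M *m x).

Lemma mx_norm_le m n (A : 'M[R]_(m, n)) c :
  0 <= c -> (forall i j, `|A i j| <= c) -> mx_norm A <= c.
Proof.
move=> c0 Ac; rewrite mx_normE.
have -> : c = (NngNum c0)%:num by [].
rewrite num_le; apply/bigmax_leP; split=> [|[i j] _]; first by rewrite -num_le.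
by rewrite -num_le /=; exact: Ac.
Qed.

Lemma ler_mx_norm m n (A : 'M[R]_(m, n)) i j : `|A i j| <= mx_norm A.
Proof.
rewrite mx_normE -[leLHS]nngE num_le.
exact: (le_bigmax _ (fun ij => `|A ij.1 ij.2|%:nng) (i, j)).
Qed.

Lemma gauge_ge0 x : 0 <= gauge x.
Proof. by rewrite /gauge mx_normE. Qed.

Lemma gaugeD x y : gauge (x + y) <= gauge x + gauge y.
Proof. by rewrite /gauge mulmxDr; exact: ler_mx_norm_add. Qed.

Lemma gaugeN x : gauge (- x) = gauge x.
Proof. by rewrite /gauge mulmxN; exact: mx_normN. Qed.

Lemma gauge0 : gauge 0 = 0.
Proof. by rewrite /gauge mulmx0; exact: mx_norm0. Qed.

Lemma gauge_euclid : exists2 c, 0 <= c & forall x, gauge x <= c * euclid x.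
Proof.
pose c := \sum_i \sum_j `|invmx M i j|.
have c0 : 0 <= c by apply: sumr_ge0 => i _; apply: sumr_ge0.
exists c => // x; have e0 : 0 <= euclid x by exact: sqrtr_ge0.
apply: mx_norm_le => [|i j]; first exact: mulr_ge0.
rewrite mxE; apply: le_trans (ler_norm_sum _ _ _) _.
rewrite /c mulr_suml [leRHS](bigD1 i)//=.
apply: le_trans (_ : \sum_k `|invmx M i k| * euclid x <= _); last first.
  rewrite mulr_suml lerDl; apply: sumr_ge0 => k _; apply: mulr_ge0 => //.
  exact: sumr_ge0.
apply: ler_sum => k _; rewrite normrM ler_wpM2l// ord1.
rewrite -(ger0_norm e0) -ler_sqr ?nnegrE// !real_normK ?num_real//.
rewrite sqr_sqrtr; last by apply: sumr_ge0 => *; exact: sqr_ge0.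
by rewrite (bigD1 k)//= lerDl; apply: sumr_ge0 => *; exact: sqr_ge0.
Qed.

Context (Munit : M \in unitmx).

Lemma boxE r x : box M r x <-> gauge x <= r.
Proof.
split=> [[y /= yr <-]|xr]; first by rewrite /gauge mulKmx.
by exists (invmx M *m x) => //; rewrite mulKVmx.
Qed.

Fact lattice_of_int_proof (k : 'cV[int]_d) :
  M *m map_mx intr k \in lattice_pred M.
Proof. by rewrite unfold_in; apply/asboolP; exists k. Qed.

Definition lattice_of_int k : lattice M := Lattice (lattice_of_int_proof k).

Lemma lattice_of_intP (z : lattice M) : exists k, z = lattice_of_int k.
Proof. by have /asboolP[k zk] := latticeP z; exists k; exact: val_inj. Qed.

Lemma lattice_of_intB k l : lattice_of_int (k - l) = lattice_of_int k - lattice_of_int l.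
Proof. by apply: val_inj; rewrite /= map_mxB mulmxBr. Qed.

Lemma gauge_lattice_of_int k (n : nat) :
  (gauge (lattice_of_int k) <= n%:R) <-> forall i, `|k i 0| <= n%:Z.
Proof.
rewrite /gauge /= mulKmx//; split=> [kn i|kn].
  have := le_trans (ler_mx_norm _ i 0) kn.
  by rewrite mxE -intr_norm -[n%:R]/(n%:Z%:~R) ler_int.
apply: mx_norm_le => // i j; rewrite ord1 mxE -intr_norm -[n%:R]/(n%:Z%:~R).
by rewrite ler_int.
Qed.

Lemma gauge_eq0 (z : lattice M) : gauge z <= 0 -> z = 0.
Proof.
have [k ->] := lattice_of_intP z.
move=> /(gauge_lattice_of_int k 0) k0; apply: val_inj => /=.
have -> : k = 0.
  apply/matrixP => i j; rewrite ord1 mxE; apply/eqP.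
  by rewrite -normr_eq0 eq_le normr_ge0 andbT; exact: k0.
by rewrite map_mx0 mulmx0.
Qed.

Definition in_box (n : nat) (z : lattice M) : R := (gauge z <= n%:R)%R%:R.

Lemma in_box_ge0 n z : 0 <= in_box n z.
Proof. exact: ler0n. Qed.

Definition box_count (n : nat) : \bar R :=
  (\esum_(z in [set: lattice M]) (in_box n z)%:E)%E.

(** The translates of the box of size [n] by the vectors with coordinates
    in [{- m, 0, m}] cover the box of size [n + m]. *)
Lemma box_count_doubling n m : (m <= n.+1)%N ->
  (box_count (n + m) <= ((3 ^ d)%N%:R)%:E * box_count n)%E.
Proof.
move=> mn.
pose a (v : {ffun 'I_d -> 'I_3}) : lattice M :=
  lattice_of_int (\col_i (m%:Z * ((v i : nat)%:Z - 1))).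
have cover (z : lattice M) : gauge z <= (n + m)%:R ->
    exists v, gauge (z - a v : lattice M) <= n%:R.
  have [k ->] := lattice_of_intP z.
  move=> /gauge_lattice_of_int kb.
  pose v := [ffun i : 'I_d => (if n%:Z < k i 0 then inord 2 else
      if k i 0 < - n%:Z then inord 0 else inord 1) : 'I_3].
  exists v; rewrite -lattice_of_intB; apply/gauge_lattice_of_int => i.
  rewrite !mxE ffunE; have := kb i; rewrite !ler_norml; move: (k i 0) => t.
  by case: ifPn => [h1|h1]; [|case: ifPn => [h2|h2]]; rewrite inordK//; lia.
have pt (z : lattice M) : ((in_box (n + m) z)%:E <=
    \sum_(v <- index_enum {ffun 'I_d -> 'I_3}) (in_box n (z - a v))%:E)%E.
  rewrite sumEFin lee_fin {1}/in_box.
  have [/cover[v zv]|_] := boolP (gauge z <= _); last first.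
    by apply: sumr_ge0 => v _; exact: in_box_ge0.
  rewrite (bigD1 v)//= {1}/in_box zv lerDl.
  by apply: sumr_ge0 => w _; exact: in_box_ge0.
apply: le_trans (le_esum (fun z _ => pt z)) _.
rewrite (@esum_sum _ _ _ setT _ xpredT); last first.
  by move=> z v _ _; rewrite lee_fin in_box_ge0.
have Vv v : (\esum_(z in [set: lattice M]) (in_box n (z - a v))%:E)%E = box_count n.
  rewrite (@esum_reindex_inj R _ (fun z => z - a v) (fun z => z + a v)
    (fun z => (in_box n z)%:E))//.
  - by move=> z; rewrite subrK.
  - by move=> z; rewrite addrK.
rewrite (eq_bigr (fun _ => 1%:E * box_count n)%E) => [|v _]; last first.
  by rewrite Vv mul1e.
rewrite -ge0_sume_distrl => [|v _]; last by rewrite lee_fin.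
rewrite sumEFin (_ : \sum_(v <- _) 1 = (3 ^ d)%N%:R)//.
by rewrite (sumr_const {ffun 'I_d -> 'I_3}) card_ffun !card_ord.
Qed.

Lemma box_count_ge1 n : (1%:E <= box_count n)%E.
Proof.
have := esum_ge_fset (in_box n) [fset 0]%fset; rewrite big_seq_fset1.
by rewrite {1}/in_box gauge0 ler0n.
Qed.

Lemma box_count_lty n : (box_count n < +oo)%E.
Proof.
elim: n => [|n IH].
  apply: (@le_lt_trans _ _ 1%:E); last exact: ltry.
  apply: ge_esum_fset => X.
  have in0 (z : lattice M) : z != 0 -> in_box 0 z = 0.
    move=> z0; rewrite /in_box; case: (boolP (gauge z <= 0)) => // /gauge_eq0 zE.
    by rewrite zE eqxx in z0.
  have [X0|X0] := boolP (0 \in X); last first.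
    rewrite big_seq big1// => z zX; apply: in0; apply: contraNN X0 => /eqP <-.
    exact: zX.
  rewrite (big_fsetD1 0)//= big_seq big1 ?addr0 => [|z].
    by rewrite /in_box gauge0 lexx.
  by rewrite !inE => /andP[z0 _]; exact: in0.
have := box_count_doubling (ltn0Sn n) ; rewrite addn1 => /le_lt_trans; apply.
by apply: lte_mul_pinfty; rewrite ?lee_fin.
Qed.

Definition tent (n : nat) (z : lattice M) : R :=
  Num.max 0 (1 - gauge z / (2 * n)%N%:R).

Lemma tent_ge0 n z : 0 <= tent n z.
Proof. by rewrite /tent le_max lexx. Qed.

Lemma tent_le1 n z : tent n z <= 1.
Proof. by rewrite /tent ge_max ler01 gerBl divr_ge0// gauge_ge0. Qed.

Lemma tent_support n (z : lattice M) : (0 < n)%N -> tent n z != 0 -> gauge z <= (2 * n)%N%:R.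
Proof.
move=> n0; apply: contraNT; rewrite -ltNge => nz; apply/eqP/max_idPl.
rewrite subr_le0 ler_pdivlMr ?mul1r ?ltW//.
by rewrite ltr0n muln_gt0.
Qed.

Lemma tent_half n (z : lattice M) : (0 < n)%N -> gauge z <= n%:R -> 2^-1 <= tent n z.
Proof.
move=> n0 zn; rewrite /tent le_max; apply/orP; right.
have n0R : 0 < n%:R :> R by rewrite ltr0n.
have : gauge z / (2 * n)%N%:R <= 2^-1.
  by rewrite natrM invfM mulrCA ler_piMr ?invr_ge0// ler_pdivrMr// mul1r.
by move: (gauge z / _) => t; lra.
Qed.

Lemma tent_lipschitz n (z w : lattice M) :
  (tent n z - tent n w) ^+ 2 <= (gauge (z - w : lattice M) / (2 * n)%N%:R) ^+ 2.
Proof.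
have i0 : 0 <= (2 * n)%N%:R^-1 :> R by rewrite invr_ge0.
have h1 : gauge z / (2 * n)%N%:R <=
    gauge (z - w : lattice M) / (2 * n)%N%:R + gauge w / (2 * n)%N%:R.
  by rewrite -mulrDl ler_wpM2r//; have := gaugeD (z - w : lattice M) w; rewrite /= subrK.
have h2 : gauge w / (2 * n)%N%:R <=
    gauge (z - w : lattice M) / (2 * n)%N%:R + gauge z / (2 * n)%N%:R.
  rewrite -mulrDl ler_wpM2r//; have := gaugeD (w - z : lattice M) z; rewrite /= subrK.
  by rewrite -opprB gaugeN.
have h3 : 0 <= gauge (z - w : lattice M) / (2 * n)%N%:R.
  by rewrite mulr_ge0// gauge_ge0.
rewrite -[leLHS]real_normK ?num_real// ler_sqr ?nnegrE// ler_norml /tent.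
move: (gauge z / _) (gauge w / _) (gauge (z - w : lattice M) / _) h1 h2 h3 => p q s.
clear; move=> h1 h2 h3; case: (leP 0 (1 - p)) => h4; case: (leP 0 (1 - q)) => h5; lra.
Qed.

(** The Lipschitz cutoff at scale [n], whose squared increments under a shift by
    [h] sum to at most a multiple of [(gauge M h / n) ^ 2] times the sum [K] of
    its squares. Both sums count, up to factors depending on [d] only, the points
    of the box of size [n]: from below because [tent] is at least 1/2 there, from
    above because it is supported in the box of size [2 * n]. *)
Lemma cutoff_exists : exists2 c : R, 0 <= c & forall n, (0 < n)%N ->
  exists (chi : lattice M -> R) (K : R), 0 < K /\
  [/\ forall z, 0 <= chi z <= 1,
      forall z, chi z != 0 -> gauge z <= (2 * n)%N%:R,
      (\esum_(z in [set: lattice M]) (chi z ^+ 2)%:E = K%:E)%E &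
      forall h : lattice M,
        (\esum_(z in [set: lattice M]) ((chi (z - h) - chi z) ^+ 2)%:E
         <= (c * (gauge h / n%:R) ^+ 2 * K)%:E)%E].
Proof.
exists (2 * (3 ^ d)%N%:R) => [|n n0]; first by rewrite mulr_ge0.
have n0R : 0 < n%:R :> R by rewrite ltr0n.
pose chi := tent n; pose KE := (\esum_(z in [set: lattice M]) (chi z ^+ 2)%:E)%E.
have in_box_tent z : chi z ^+ 2 <= in_box (2 * n) z.
  have [->|z0] := eqVneq (chi z) 0; first by rewrite expr0n in_box_ge0.
  by rewrite /in_box tent_support// expr_le1// ?tent_le1// tent_ge0.
have tent_in_box z : in_box n z <= 4 * chi z ^+ 2.
  rewrite /in_box; have [zn|_] := boolP (gauge z <= _); last first.
    by rewrite mulr_ge0// sqr_ge0.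
  have h := tent_half n0 zn; have : 2^-1 ^+ 2 <= chi z ^+ 2.
    by rewrite ler_sqr// ?nnegrE// ?invr_ge0// tent_ge0.
  have -> : (2^-1 : R) ^+ 2 = 4^-1 by rewrite exprVn -natrX.
  by move: (chi z ^+ 2) => t; clear => ht; rewrite -[leLHS]/(1 : R); lra.
have KE_fin : (KE < +oo)%E.
  apply: le_lt_trans (box_count_lty (2 * n)); apply: le_esum => z _.
  by rewrite lee_fin.
have box_KE : (box_count n <= 4%:E * KE)%E.
  rewrite /KE -esumZ// => [|z]; last exact: sqr_ge0.
  by apply: le_esum => z _; rewrite lee_fin.
have KE0 : (0 <= KE)%E by apply: esum_ge0 => z _; rewrite lee_fin sqr_ge0.
have KEK : (KE = (fine KE)%:E)%E by rewrite fineK// ge0_fin_numE.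
set K := fine KE in KEK.
have K0 : 0 < K.
  have := le_trans (box_count_ge1 n) box_KE.
  by rewrite KEK -EFinM lee_fin; clear; move: K => t t1; lra.
exists chi, K; split=> //; split=> // [z|z|h].
- by rewrite tent_ge0 tent_le1.
- exact: tent_support.
set g := (gauge h / (2 * n)%N%:R) ^+ 2.
have pt z : (chi (z - h) - chi z) ^+ 2 <=
    g * (in_box (2 * n) (z - h) + in_box (2 * n) z).
  have g0 : 0 <= g by exact: sqr_ge0.
  have lip : (chi (z - h) - chi z) ^+ 2 <= g.
    have := tent_lipschitz n (z - h) z.
    by rewrite (_ : z - h - z = - h) ?gaugeN// addrAC subrr sub0r.
  have [out1|in1] := eqVneq (chi (z - h)) 0; last first.
    apply: le_trans lip _; rewrite {1}/in_box tent_support//.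
    by rewrite ler_peMr// lerDl in_box_ge0.
  have [out2|in2] := eqVneq (chi z) 0; last first.
    apply: le_trans lip _; rewrite {2}/in_box tent_support//.
    by rewrite ler_peMr// lerDr in_box_ge0.
  by rewrite out1 out2 subrr expr0n mulr_ge0// addr_ge0 ?in_box_ge0.
apply: (@le_trans _ _ (\esum_(z in [set: lattice M])
    (g * (in_box (2 * n) (z - h) + in_box (2 * n) z))%:E)%E).
  by apply: le_esum => z _; rewrite lee_fin pt.
rewrite esumZ ?sqr_ge0// => [|z]; last by rewrite addr_ge0 ?in_box_ge0.
under eq_esum do rewrite EFinD.
rewrite esumD; do ?by move=> z _; rewrite lee_fin in_box_ge0.
rewrite (@esum_reindex_inj R _ (fun z => z - h) (fun z => z + h)
  (fun z => (in_box (2 * n) z)%:E)); last 2 first.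
- by move=> z; rewrite subrK.
- by move=> z; rewrite addrK.
rewrite -/(box_count _).
have dbl : (box_count (2 * n) <= ((3 ^ d)%N%:R * (4 * K))%:E)%E.
  rewrite mul2n -addnn; apply: le_trans (box_count_doubling (leqnSn n)) _.
  by rewrite EFinM lee_wpmul2l ?lee_fin// EFinM -KEK.
have -> : (2 * (3 ^ d)%N%:R * (gauge h / n%:R) ^+ 2 * K)%:E =
  (g%:E * (((3 ^ d)%N%:R * (4 * K))%:E + ((3 ^ d)%N%:R * (4 * K))%:E))%E.
  rewrite -EFinD -EFinM; congr EFin; rewrite /g natrM invfM !exprMn.
  have -> : (2^-1) ^+ 2 = 4^-1 :> R by rewrite exprVn -natrX.
  by move: (n%:R^-1 ^+ 2) => t; field.
by rewrite lee_wpmul2l ?lee_fin ?sqr_ge0// leeD.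
Qed.

End Gauge.

(** * The operator norm and weighted sums of vectors *)

Section OperatorNorm.
Context {R : realType} {N : nat}.
Implicit Types (u v : 'cV[R[i]]_N) (A B : 'M[R[i]]_N).

Lemma normc_sum_le (I : Type) (r : seq I) (F : I -> R[i]) :
  normc (\sum_(i <- r) F i) <= \sum_(i <- r) normc (F i).
Proof.
elim/big_ind2 : _ => [|x a y b xa yb|//]; first by rewrite normc0.
exact: le_trans (le_normcD _ _) (lerD xa yb).
Qed.

Lemma normc_ge0 (z : R[i]) : 0 <= normc z.
Proof. by case: z => a b; exact: sqrtr_ge0. Qed.

Lemma normc_le_vnorm v i : normc (v i 0) <= vnorm v.
Proof.
rewrite -ler_sqr ?nnegrE ?normc_ge0 ?vnorm_ge0// vnorm_sqr (bigD1 i)//=.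
by rewrite lerDl; apply: sumr_ge0 => j _; exact: sqr_ge0.
Qed.

Lemma mulmx_bounded B : exists2 c, 0 <= c & forall v, vnorm (B *m v) <= c * vnorm v.
Proof.
pose r i := \sum_j normc (B i j); pose s := \sum_i r i ^+ 2.
have s0 : 0 <= s by apply: sumr_ge0 => i _; exact: sqr_ge0.
exists (Num.sqrt s) => [|v]; first exact: sqrtr_ge0.
have v0 := vnorm_ge0 v.
rewrite -ler_sqr ?nnegrE ?mulr_ge0 ?sqrtr_ge0 ?vnorm_ge0//.
rewrite exprMn (sqr_sqrtr s0) (vnorm_sqr (B *m v)) mulr_suml; apply: ler_sum => i _.
have r0 : 0 <= r i by apply: sumr_ge0 => j _; exact: normc_ge0.
rewrite -exprMn ler_sqr ?nnegrE ?mulr_ge0 ?normc_ge0//.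
rewrite mxE; apply: le_trans (normc_sum_le _ _) _; rewrite mulr_suml.
apply: ler_sum => j _; rewrite normcM ler_wpM2l ?normc_ge0//.
exact: normc_le_vnorm.
Qed.

Lemma vnormZ (c : R) v : vnorm (c%:C *: v) = `|c| * vnorm v.
Proof.
apply/eqP; rewrite -(eqrXn2 (ltn0Sn 1)) ?mulr_ge0 ?vnorm_ge0//.
by rewrite vnorm_sqrZ exprMn /= expr0n addr0 sqrtr_sqr.
Qed.

Lemma opnorm_has_sup B :
  has_sup [set vnorm (B *m v) | v in [set v | vnorm v <= 1]].
Proof.
split; first by exists (vnorm (B *m 0)); exists 0 => //=; rewrite vnorm0.
have [c c0 Bc] := mulmx_bounded B; exists c => _ [v /= v1 <-].
by apply: le_trans (Bc v) _; rewrite -[leRHS]mulr1 ler_wpM2l.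
Qed.

Lemma opnorm_ge0 B : 0 <= opnorm B.
Proof.
apply: le_trans (vnorm_ge0 (B *m 0)) _.
by apply: (sup_upper_bound (opnorm_has_sup B)); exists 0 => //=; rewrite vnorm0.
Qed.

Lemma vnorm_mulmx_le B v : vnorm (B *m v) <= opnorm B * vnorm v.
Proof.
have := vnorm_ge0 v; rewrite le_eqVlt => /orP[/eqP v0|v0].
  have -> : v = 0 by apply: vnorm_sqr_eq0; rewrite -v0 expr0n.
  by rewrite mulmx0 vnorm0 mulr0.
rewrite -ler_pdivrMr//.
apply: (sup_upper_bound (opnorm_has_sup B)).
exists ((vnorm v)^-1%:C *: v) => /=.
  by rewrite vnormZ ger0_norm ?invr_ge0 ?vnorm_ge0// mulVf ?gt_eqF.
by rewrite -scalemxAr vnormZ ger0_norm ?invr_ge0 ?vnorm_ge0// mulrC.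
Qed.

Lemma opnorm_le B c : (forall v, vnorm v <= 1 -> vnorm (B *m v) <= c) ->
  opnorm B <= c.
Proof.
move=> Bc; apply: ge_sup; first exact: (opnorm_has_sup B).1.
by move=> _ [v /= v1 <-]; exact: Bc.
Qed.

Lemma vnorm_sqrB_le u v :
  vnorm (u - v) ^+ 2 <= 2 * vnorm u ^+ 2 + 2 * vnorm v ^+ 2.
Proof.
apply: le_trans (vnorm_sqrD_le _ _) _.
by rewrite -scaleN1r -(rmorphN1 (real_complex R)) vnormZ normrN1 mul1r.
Qed.

Lemma cdot_sumr (I : Type) (r : seq I) (F : I -> 'cV[R[i]]_N) u :
  cdot u (\sum_(i <- r) F i) = \sum_(i <- r) cdot u (F i).
Proof.
elim: r => [|i r IH]; last by rewrite !big_cons cdotDr IH.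
by rewrite !big_nil /cdot big1// => i _; rewrite mxE /=; ring.
Qed.

(** Cauchy-Schwarz with weights [b * w] and [b / w]: each term is compared with
    the total sum by Young's inequality, with parameter [b i * w i / S]. *)
Lemma weighted_cauchy_schwarz (I : eqType) (r : seq I)
    (F : I -> 'cV[R[i]]_N) (b w f : I -> R) :
  (forall i, i \in r -> 0 <= b i) -> (forall i, i \in r -> 0 < w i) ->
  (forall i, i \in r -> vnorm (F i) ^+ 2 <= b i ^+ 2 * f i) ->
  vnorm (\sum_(i <- r) F i) ^+ 2 <=
    (\sum_(i <- r) b i * w i) * \sum_(i <- r) b i / w i * f i.
Proof.
move=> b0 w0 Ff; set U := \sum_(i <- r) F i.
set S := \sum_(i <- r) b i * w i; set T := \sum_(i <- r) b i / w i * f i.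
have bw0 i : i \in r -> 0 <= b i * w i.
  by move=> ir; rewrite mulr_ge0 ?b0// ltW// w0.
have S0 : 0 <= S by rewrite /S big_seq sumr_ge0.
have F0 i : i \in r -> b i = 0 -> F i = 0.
  move=> ir bi0; apply: vnorm_sqr_eq0; apply/eqP; rewrite eq_le sqr_ge0 andbT.
  by apply: le_trans (Ff i ir) _; rewrite bi0 expr0n mul0r.
have [S_eq0|Sn0] := eqVneq S 0.
  have U0 : U = 0.
    rewrite /U big_seq big1// => i ir; apply: F0 => //.
    have : \sum_(j <- r | j \in r) b j * w j == 0 by rewrite -big_seq -/S S_eq0.
    rewrite psumr_eq0// => /allP /(_ i ir); rewrite ir /= mulf_eq0.
    by rewrite (gt_eqF (w0 _ ir)) orbF => /eqP.
  by rewrite U0 vnorm0 S_eq0 mul0r expr0n.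
have Sp : 0 < S by rewrite lt_neqAle eq_sym Sn0.
have young i : i \in r -> 2 * S * cdot U (F i) <=
    S ^+ 2 * (b i / w i * f i) + b i * w i * vnorm U ^+ 2.
  move=> ir; have [bi0|bi] := eqVneq (b i) 0.
    rewrite (F0 _ ir bi0) bi0 !mul0r mulr0 add0r.
    by have := cdotZr 0 U 0; rewrite scaler0 mul0r => ->; rewrite mulr0.
  have bp : 0 < b i by rewrite lt_neqAle eq_sym bi b0.
  have bwp : 0 < b i * w i by rewrite mulr_gt0// w0.
  rewrite -(ler_pM2l bwp).
  have h1 := sqr_ge0 (vnorm ((S%:C *: F i) + (- (b i * w i))%:C *: U)).
  rewrite vnorm_sqr_lin vnormZ exprMn real_normK ?num_real// in h1.
  rewrite (cdotC _ U) cdotZr in h1.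
  have h2 : S ^+ 2 * vnorm (F i) ^+ 2 <= S ^+ 2 * (b i ^+ 2 * f i).
    by rewrite ler_wpM2l ?sqr_ge0// Ff.
  have -> : b i * w i * (S ^+ 2 * (b i / w i * f i) + b i * w i * vnorm U ^+ 2)
      = S ^+ 2 * (b i ^+ 2 * f i) + (b i * w i) ^+ 2 * vnorm U ^+ 2.
    have wV : w i * (w i)^-1 = 1 by rewrite mulfV// gt_eqF// w0.
    transitivity (S ^+ 2 * (b i ^+ 2 * f i) * (w i * (w i)^-1) +
      (b i * w i) ^+ 2 * vnorm U ^+ 2); first by ring.
    by rewrite wV mulr1.
  move: h1 h2; move: (cdot U (F i)) (vnorm U ^+ 2) (vnorm (F i) ^+ 2) (b i * w i).
  by move: (b i ^+ 2 * f i) => x1 x2 x3 x4 x5; clear => h1 h2; lra.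
have : 2 * S * vnorm U ^+ 2 <= S ^+ 2 * T + S * vnorm U ^+ 2.
  have -> : S * vnorm U ^+ 2 = \sum_(i <- r) b i * w i * vnorm U ^+ 2.
    by rewrite mulr_suml.
  have -> : S ^+ 2 * T = \sum_(i <- r) S ^+ 2 * (b i / w i * f i).
    by rewrite mulr_sumr.
  have -> : 2 * S * vnorm U ^+ 2 = \sum_(i <- r) 2 * S * cdot U (F i).
    by rewrite vnorm_sqr_cdot -mulr_sumr -cdot_sumr.
  by rewrite -big_split [leLHS]big_seq [leRHS]big_seq; apply: ler_sum.
move=> h; rewrite -(ler_pM2l Sp); move: h; move: (vnorm U ^+ 2) => x.
by clear => h; lra.
Qed.

End OperatorNorm.

(** * Localization of approximate eigenvectors *)

Section DoubleSums.
Context {R : realType} {L : choiceType}.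

Lemma exchange_esum (T : choiceType) (f : L -> T -> R) : (forall x y, 0 <= f x y) ->
  (\esum_(x in [set: L]) \esum_(y in [set: T]) (f x y)%:E =
   \esum_(y in [set: T]) \esum_(x in [set: L]) (f x y)%:E)%E.
Proof.
move=> f0; rewrite !esum_esum; do ?by move=> *; rewrite lee_fin.
have -> : [set: L] `*`` (fun=> [set: T]) = setT by apply/seteqP.
have -> : [set: T] `*`` (fun=> [set: L]) = setT by apply/seteqP.
rewrite [RHS](@reindex_esum _ _ _ [set: L * T] _ (fun z => (z.2, z.1)))//.
split=> //; first by move=> [x y] [x' y'] _ _ /= [-> ->].
by move=> [y x] _; exists (x, y).
Qed.

End DoubleSums.

(** After exchanging the sums, the inner one runs over the reflected translate
    [y => x - y] of the whole lattice. *)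
Lemma esum_convolution {R : realType} {L : zmodType} (f g : L -> R) (s : R) :
  (forall x, 0 <= f x) -> (forall x, 0 <= g x) ->
  (\esum_(x in [set: L]) (f x)%:E = s%:E)%E ->
  (\esum_(y in [set: L]) \esum_(x in [set: L]) (f (x - y) * g x)%:E =
   s%:E * \esum_(x in [set: L]) (g x)%:E)%E.
Proof.
move=> f0 g0 fs; rewrite exchange_esum => [|x y]; last exact: mulr_ge0.
have s0 : 0 <= s by rewrite -lee_fin -fs; apply: esum_ge0 => x _; rewrite lee_fin.
rewrite -esumZ//; apply: eq_esum => x _.
under eq_esum do rewrite mulrC.
rewrite esumZ// EFinM muleC; congr (_ * _)%E.
rewrite -fs (esum_reindex_inj (e := fun y => x - y) (e' := fun y => x - y) (fun y => (f y)%:E))//.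
- by move=> y; rewrite opprB addrC subrK.
- by move=> y; rewrite opprB addrC subrK.
Qed.

Section Localization.
Context {R : realType} {d : nat} {M : 'M[R]_d}.

Lemma esum_pair {L : choiceType} (f : L -> L -> R) : (forall x y, 0 <= f x y) ->
  (\esum_(x in [set: L]) \esum_(y in [set: L]) (f x y)%:E =
   \esum_(p in [set: L * L]) (f p.1 p.2)%:E)%E.
Proof.
move=> f0; rewrite esum_esum; last by move=> *; rewrite lee_fin.
by have -> : [set: L] `*`` (fun=> [set: L]) = setT by apply/seteqP.
Qed.

Lemma esum_sumr {L I : choiceType} (r : seq I) (f : I -> L -> R) :
  (forall i x, i \in r -> 0 <= f i x) ->
  (\esum_(x in [set: L]) (\sum_(i <- r) f i x)%:E =
   \sum_(i <- r) \esum_(x in [set: L]) (f i x)%:E)%E.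
Proof.
move=> f0; rewrite [RHS]big_seq -esum_sum => [|x i _ ir]; last first.
  by rewrite lee_fin f0.
by apply: eq_esum => x _; rewrite -big_seq sumEFin.
Qed.

Lemma ell2_cut_proof {N} (chi : lattice M -> R) (y : lattice M) (psi : ell2 M N) :
  (forall z, 0 <= chi z <= 1) ->
  (fun x => (chi (x - y))%:C *: psi x) \in ell2_pred M N.
Proof.
move=> chiP; rewrite unfold_in; apply/asboolP.
apply: le_lt_trans (ell2_esum_fin psi); apply: le_esum => x _.
rewrite lee_fin vnormZ exprMn -[leRHS]mul1r ler_wpM2r ?sqr_ge0//.
by have /andP[c0 c1] := chiP (x - y); rewrite ger0_norm// expr_le1.
Qed.

(** The weight of the hop [h] in [ham_norm1]. *)
Definition weight (h : lattice M) : R := Num.sqrt (1 + euclid h ^+ 2).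

Lemma weight_sqr h : weight h ^+ 2 = 1 + euclid h ^+ 2.
Proof. by rewrite sqr_sqrtr// addr_ge0// sqr_ge0. Qed.

Lemma weight_ge1 h : 1 <= weight h.
Proof.
rewrite -[leLHS]sqrtr1; apply: ler_wsqrtr.
by rewrite lerDl sqr_ge0.
Qed.

Lemma weight_gt0 h : 0 < weight h.
Proof. exact: lt_le_trans ltr01 (weight_ge1 h). Qed.

Lemma euclid_weight h : (weight h)^-1 * euclid h ^+ 2 <= weight h.
Proof.
by rewrite ler_pdivrMl ?weight_gt0// -expr2 weight_sqr lerDr.
Qed.

Context (Munit : M \in unitmx).

(** Averaging over all translates of the cutoff: up to constants and the common
    factor [K], the squared defects of the pieces add up to at most that of [psi]
    plus a commutator term of size [(S / n) ^ 2] times [sqn psi], while the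
    squared norms of the pieces add up to [sqn psi]; so some piece is as good as
    the average. *)
Lemma localization : exists2 C : R, 0 <= C &
  forall (N : nat) (T : ell2 M N -> ell2 M N) (s : seq (lattice M))
    (B : lattice M -> lattice M -> 'M[R[i]]_N) (b : lattice M -> R),
  (forall psi x, T psi x = \sum_(h <- s) B h x *m psi (x - h)) ->
  (forall h, h \in s -> 0 <= b h) ->
  (forall h x v, h \in s -> vnorm (B h x *m v) ^+ 2 <= b h ^+ 2 * vnorm v ^+ 2) ->
  forall (n : nat) (l e kappa : R) (psi : ell2 M N), (0 < n)%N ->
  0 < sqn psi -> sqn (T psi - l%:C *: psi) <= e * sqn psi ->
  2 * e + C * ((\sum_(h <- s) b h * weight h) / n%:R) ^+ 2 < kappa ->
  exists (y : lattice M) (phi : ell2 M N),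
    (forall x, phi x != 0 -> gauge M (x - y : lattice M) <= (2 * n)%N%:R) /\
    sqn (T phi - l%:C *: phi) < kappa * sqn phi.
Proof.
have [c c0 cutoff] := cutoff_exists Munit.
have [g g0 gE] := gauge_euclid M.
exists (2 * (c * g ^+ 2)) => [|N T s B b TE b0 Bb n l e kappa psi n0 psi0 Tpsi].
  by rewrite !mulr_ge0// sqr_ge0.
set S := \sum_(h <- s) _ => kap.
have [chi [K [K0 [chiP chi_supp chiK chi_lip]]]] := cutoff n n0.
pose phi y := Ell2 (ell2_cut_proof y psi chiP).
have phiE y x : phi y x = (chi (x - y))%:C *: psi x by [].
clearbody phi.
apply: contrapT => none.
have {}none y : kappa * sqn (phi y) <= sqn (T (phi y) - l%:C *: phi y).
  rewrite leNgt; apply/negP => lt_y; apply: none; exists y, (phi y); split=> // x.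
  rewrite phiE => nz; apply: chi_supp; apply: contraNneq nz => ->.
  by rewrite scale0r.
pose D h z := (chi (z - h) - chi z) ^+ 2.
have D0 h z : 0 <= D h z by exact: sqr_ge0.
pose def x := vnorm ((T psi - l%:C *: psi) x) ^+ 2.
have pt y x : vnorm ((T (phi y) - l%:C *: phi y) x) ^+ 2 <=
   2 * (chi (x - y) ^+ 2 * def x) +
   2 * (S * \sum_(h <- s) b h / weight h * (D h (x - y) * vnorm (psi (x - h)) ^+ 2)).
  have -> : (T (phi y) - l%:C *: phi y) x =
     (chi (x - y))%:C *: (T psi - l%:C *: psi) x +
     \sum_(h <- s) B h x *m ((chi (x - y - h) - chi (x - y))%:C *: psi (x - h)).
    rewrite !ell2B !ell2Z !TE scalerBr scaler_sumr addrAC -big_split/= phiE.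
    congr (_ - _); last by rewrite !scalerA mulrC.
    apply: eq_bigr => h _; rewrite phiE (addrAC x) -scalemxAr -scalemxAr -scalerDl.
    by rewrite -rmorphD [_ + (_ - _)]addrC subrK.
  apply: le_trans (vnorm_sqrD_le _ _) _.
  rewrite vnormZ exprMn real_normK ?num_real// lerD2l ler_pM2l//.
  apply: weighted_cauchy_schwarz => [||h hs]; [exact: b0| |].
    by move=> h _; exact: weight_gt0.
  apply: le_trans (Bb _ _ _ hs) _.
  by rewrite vnormZ exprMn real_normK// num_real.
have S0 : 0 <= S.
  rewrite /S big_seq; apply: sumr_ge0 => h hs.
  by rewrite mulr_ge0 ?b0// ltW// weight_gt0.
pose q h := b h / weight h.
have q0 h : h \in s -> 0 <= q h.
  by move=> hs; rewrite divr_ge0 ?b0// ltW// weight_gt0.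
pose u h x := vnorm (psi (x - h)) ^+ 2.
have u0 h x : 0 <= u h x by exact: sqr_ge0.
have uE h : (\esum_(x in [set: lattice M]) (u h x)%:E = (sqn psi)%:E)%E.
  rewrite sqnE (esum_reindex_inj (e := fun x => x - h) (e' := fun x => x + h)
    (fun x => (vnorm (psi x) ^+ 2)%:E))//.
  - by move=> x; rewrite subrK.
  - by move=> x; rewrite addrK.
pose E := sqn (T psi - l%:C *: psi).
have defE : (\esum_(x in [set: lattice M]) (def x)%:E = E%:E)%E by rewrite sqnE.
have def0 x : 0 <= def x by exact: sqr_ge0.
pose t h := fine (\esum_(z in [set: lattice M]) (D h z)%:E)%E.
have tE h : (\esum_(z in [set: lattice M]) (D h z)%:E = (t h)%:E)%E.
  rewrite fineK// ge0_fin_numE; last by apply: esum_ge0 => z _; rewrite lee_fin.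
  exact: le_lt_trans (chi_lip h) (ltry _).
have t_le h : t h <= c * (gauge M h / n%:R) ^+ 2 * K.
  by rewrite -lee_fin -tE; exact: chi_lip.
have upper : (\esum_(y in [set: lattice M]) (sqn (T (phi y) - l%:C *: phi y))%:E <=
    (2 * (K * E) + 2 * (S * \sum_(h <- s) q h * (t h * sqn psi)))%:E)%E.
  pose f1 y x := chi (x - y) ^+ 2 * def x.
  pose f2 y x := \sum_(h <- s) q h * (D h (x - y) * u h x).
  have f10 y x : 0 <= f1 y x by rewrite mulr_ge0// sqr_ge0.
  have f20 y x : 0 <= f2 y x.
    rewrite /f2 big_seq; apply: sumr_ge0 => h hs.
    by apply: mulr_ge0; [exact: q0|exact: mulr_ge0].
  have Sf20 y x : 0 <= S * f2 y x by exact: mulr_ge0.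
  have f1'0 y x : 0 <= 2 * f1 y x by exact: mulr_ge0.
  have f2'0 y x : 0 <= 2 * (S * f2 y x) by exact: mulr_ge0.
  apply: (@le_trans _ _ (\esum_(y in [set: lattice M])
      \esum_(x in [set: lattice M]) (2 * f1 y x + 2 * (S * f2 y x))%:E)%E).
    apply: le_esum => y _; rewrite sqnE; apply: le_esum => x _.
    by rewrite lee_fin; exact: pt.
  rewrite esum_pair => [|y x]; last exact: addr_ge0.
  under eq_esum do rewrite EFinD.
  rewrite esumD; [|by move=> p _; rewrite lee_fin..].
  rewrite (esumZ (f := fun p => f1 p.1 p.2))//.
  rewrite (esumZ (f := fun p => S * f2 p.1 p.2))//.
  rewrite (esumZ (f := fun p => f2 p.1 p.2))//.
  rewrite [leRHS]EFinD (EFinM 2 (K * E)) (EFinM 2 (S * _)) (EFinM S) (EFinM K).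
  apply: leeD; (apply: lee_wpmul2l; first by rewrite lee_fin).
    rewrite -(esum_pair f10) (esum_convolution _ def0 chiK) ?defE// => z.
    exact: sqr_ge0.
  apply: lee_wpmul2l; first by rewrite lee_fin.
  rewrite esum_sumr => [|h p hs]; last first.
    by apply: mulr_ge0; [exact: q0|exact: mulr_ge0].
  rewrite -sumEFin big_seq [leRHS]big_seq; apply: lee_sum => h hs.
  rewrite esumZ ?q0// => [|p]; last exact: mulr_ge0.
  rewrite (EFinM (q h)); apply: lee_wpmul2l; first by rewrite lee_fin q0.
  rewrite -(esum_pair (f := fun y x => D h (x - y) * u h x)) => [|y x]; last first.
    exact: mulr_ge0.
  by rewrite (esum_convolution (D0 h) (u0 h) (tE h)) uE EFinM.
have e0 : 0 <= e.
  rewrite -(pmulr_lge0 _ psi0); exact: le_trans (sqn_ge0 _) Tpsi.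
have kappa0 : 0 <= kappa.
  apply: le_trans (ltW kap); apply: addr_ge0; first exact: mulr_ge0.
  by rewrite !mulr_ge0// sqr_ge0.
have lower : (\esum_(y in [set: lattice M]) (kappa * sqn (phi y))%:E =
    (kappa * (K * sqn psi))%:E)%E.
  rewrite esumZ// => [|y]; last exact: sqn_ge0.
  rewrite EFinM; congr (_ * _)%E.
  under eq_esum => y _.
    rewrite sqnE; under eq_esum do rewrite phiE vnormZ exprMn real_normK ?num_real//.
    over.
  rewrite (esum_convolution _ _ chiK) => [|z|x]; [|exact: sqr_ge0..].
  by rewrite -sqnE.
have main : kappa * (K * sqn psi) <=
    2 * (K * E) + 2 * (S * \sum_(h <- s) q h * (t h * sqn psi)).
  rewrite -lee_fin -lower; apply: le_trans upper.
  by apply: le_esum => y _; rewrite lee_fin.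
have comm : \sum_(h <- s) q h * (t h * sqn psi) <=
    c * g ^+ 2 / n%:R ^+ 2 * S * (K * sqn psi).
  rewrite /S mulr_sumr mulr_suml big_seq [leRHS]big_seq; apply: ler_sum => h hs.
  have ht : t h <= c * (g ^+ 2 * euclid h ^+ 2 / n%:R ^+ 2) * K.
    apply: le_trans (t_le h) _; rewrite ler_wpM2r ?(ltW K0)// ler_wpM2l//.
    rewrite expr_div_n ler_wpM2r ?invr_ge0 ?sqr_ge0// -exprMn ler_sqr ?nnegrE.
    - exact: gE.
    - exact: gauge_ge0.
    - by rewrite mulr_ge0// sqrtr_ge0.
  have hw := euclid_weight h.
  apply: (@le_trans _ _ (q h * (c * (g ^+ 2 * euclid h ^+ 2 / n%:R ^+ 2) * K * sqn psi))).
    by rewrite ler_wpM2l ?q0// ler_wpM2r// sqn_ge0.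
  have r0 : 0 <= c * g ^+ 2 / n%:R ^+ 2 * b h * (K * sqn psi).
    apply: mulr_ge0; last by apply: mulr_ge0; [exact: ltW|exact: sqn_ge0].
    by rewrite mulr_ge0 ?b0// divr_ge0 ?mulr_ge0 ?sqr_ge0.
  apply: (@le_trans _ _ (c * g ^+ 2 / n%:R ^+ 2 * b h * (K * sqn psi) *
     ((weight h)^-1 * euclid h ^+ 2))).
    by rewrite /q le_eqVlt; apply/orP; left; apply/eqP; ring.
  apply: le_trans (ler_wpM2l r0 hw) _.
  by rewrite le_eqVlt; apply/orP; left; apply/eqP; ring.
have Kpsi : 0 < K * sqn psi by rewrite mulr_gt0.
move: main; apply/negP; rewrite -ltNge.
apply: (@le_lt_trans _ _
    ((2 * e + 2 * (c * g ^+ 2) * (S / n%:R) ^+ 2) * (K * sqn psi))); last first.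
  by rewrite ltr_pM2r.
rewrite [leRHS]mulrDl; apply: lerD.
  by rewrite -!mulrA ler_pM2l// [leRHS]mulrCA ler_pM2l//; exact: Tpsi.
rewrite -[leRHS]mulrA -[leRHS]mulrA ler_pM2l//.
apply: le_trans (ler_wpM2l S0 comm) _; rewrite expr_div_n.
by rewrite le_eqVlt; apply/orP; left; apply/eqP; ring.
Qed.

End Localization.

(** * Finite range Hamiltonians *)

Section Hopping.
Context {R : realType} {d : nat} {M : 'M[R]_d} {A : finType} {N : nat}.
Implicit Types (t : config M A -> 'M[R[i]]_N) (H : hamiltonian M A N).
Implicit Types (xi eta : config M A).

(** The hopping constant bounds the oscillation of [t], so the supremum defining
    [supnorm t] is over a bounded set. *)
Lemma supnorm_ge t r c xi : hop_constant t r c -> opnorm (t xi) <= supnorm t.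
Proof.
move=> [c1 tc]; have c0 : 0 <= c by exact: le_trans c1.
apply: sup_upper_bound; last by exists xi.
split; first by exists (opnorm (t xi)), xi.
exists (2 * (opnorm (t xi) + c)) => _ [eta _ <-].
have diff : opnorm (t eta - t xi) <= c.
  apply: le_trans (tc eta xi) _; rewrite -[leRHS]mulr1 ler_wpM2l//.
  set X := [set _ | _ in _]; have X1 : ubound X 1.
    by move=> _ [y _ <-]; rewrite /alphabet_dist lern1 leq_b1.
  have [->|/set0P X0] := eqVneq X set0; first by rewrite sup0.
  exact: ge_sup.
apply: opnorm_le => v v1.
have a0 := opnorm_ge0 (t xi).
have b0 := opnorm_ge0 (t eta - t xi).
have le1 (B : 'M[R[i]]_N) : vnorm (B *m v) <= opnorm B.
  apply: le_trans (vnorm_mulmx_le B v) _.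
  by rewrite -[leRHS]mulr1 ler_wpM2l ?opnorm_ge0.
have sq (x y : R) : 0 <= x -> x <= y -> x ^+ 2 <= y ^+ 2.
  by move=> x0 xy; rewrite ler_sqr ?nnegrE// (le_trans x0).
have ac0 : 0 <= 2 * (opnorm (t xi) + c) := mulr_ge0 (ler0n R 2) (addr_ge0 a0 c0).
rewrite -(ler_sqr (vnorm_ge0 _) ac0).
have -> : t eta *m v = (t eta - t xi) *m v + t xi *m v by rewrite -mulmxDl subrK.
apply: le_trans (vnorm_sqrD_le _ _) _.
have h1 := sq _ _ (vnorm_ge0 _) (le_trans (le1 (t eta - t xi)) diff).
have h2 := sq _ _ (vnorm_ge0 _) (le1 (t xi)).
have h3 := mulr_ge0 a0 c0.
have h4 := sqr_ge0 c; have h5 := sqr_ge0 (opnorm (t xi)).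
move: h1 h2 h3 h4 h5; move: (vnorm _ ^+ 2) (vnorm _ ^+ 2) (opnorm (t xi)) => x y z.
by clear => h1 h2 h3 h4 h5; rewrite expr2 in h1 h2 h4 h5 *; lra.
Qed.

(** A Schur test; since [weight] is at least 1, the weights [b / weight] of the
    second factor are dominated by [b * weight]. *)
Lemma hopping_bound (T : ell2 M N -> ell2 M N) (s : seq (lattice M))
    (B : lattice M -> lattice M -> 'M[R[i]]_N) (b : lattice M -> R) :
  (forall psi x, T psi x = \sum_(h <- s) B h x *m psi (x - h)) ->
  (forall h, h \in s -> 0 <= b h) ->
  (forall h x v, h \in s -> vnorm (B h x *m v) ^+ 2 <= b h ^+ 2 * vnorm v ^+ 2) ->
  forall psi, sqn (T psi) <= (\sum_(h <- s) b h * weight h) ^+ 2 * sqn psi.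
Proof.
move=> TE b0 Bb psi; set S := \sum_(h <- s) _.
have S0 : 0 <= S.
  rewrite /S big_seq; apply: sumr_ge0 => h hs.
  by rewrite mulr_ge0 ?b0// ltW// weight_gt0.
pose q h := b h / weight h.
have q0 h : h \in s -> 0 <= q h.
  by move=> hs; rewrite divr_ge0 ?b0// ltW// weight_gt0.
have uE h : (\esum_(x in [set: lattice M]) (vnorm (psi (x - h)) ^+ 2)%:E =
    (sqn psi)%:E)%E.
  rewrite sqnE (esum_reindex_inj (e := fun x => x - h) (e' := fun x => x + h)
    (fun x => (vnorm (psi x) ^+ 2)%:E))//.
  - by move=> x; rewrite subrK.
  - by move=> x; rewrite addrK.
have upper : ((sqn (T psi))%:E <= (S * \sum_(h <- s) q h * sqn psi)%:E)%E.
  apply: (@le_trans _ _ (\esum_(x in [set: lattice M])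
      (S * \sum_(h <- s) q h * vnorm (psi (x - h)) ^+ 2)%:E)%E).
    rewrite sqnE; apply: le_esum => x _; rewrite lee_fin TE.
    apply: weighted_cauchy_schwarz => [||h hs]; [exact: b0| |exact: Bb].
    by move=> h _; exact: weight_gt0.
  have sum0 x : 0 <= \sum_(h <- s) q h * vnorm (psi (x - h)) ^+ 2.
    by rewrite big_seq; apply: sumr_ge0 => h hs; rewrite mulr_ge0 ?q0 ?sqr_ge0.
  rewrite esumZ// (EFinM S); apply: lee_wpmul2l; first by rewrite lee_fin.
  rewrite esum_sumr => [|h x hs]; last by rewrite mulr_ge0 ?q0 ?sqr_ge0.
  rewrite -sumEFin big_seq [leRHS]big_seq; apply: lee_sum => h hs.
  by rewrite esumZ ?q0// => [|x]; [rewrite uE EFinM|exact: sqr_ge0].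
rewrite -lee_fin; apply: le_trans upper _; rewrite lee_fin expr2 -mulrA.
rewrite ler_wpM2l// -mulr_suml ler_wpM2r ?sqn_ge0//.
rewrite /S big_seq [leRHS]big_seq; apply: ler_sum => h hs.
rewrite ler_wpM2l ?b0//; apply: le_trans (weight_ge1 h).
by rewrite invf_le1 ?weight_gt0// weight_ge1.
Qed.

Section Fixed.
Context (H : hamiltonian M A N) (Rt Ct : lattice M -> R).
Context (HR : forall h, h \in hop_range H -> influence_radius (hop H h) (Rt h)).
Context (HC : forall h, h \in hop_range H -> hop_constant (hop H h) (Rt h) (Ct h)).

Let b h := supnorm (hop H h).

Lemma hop_le h zeta v : h \in hop_range H ->
  vnorm (hop H h zeta *m v) ^+ 2 <= b h ^+ 2 * vnorm v ^+ 2.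
Proof.
move=> hs; have h1 := supnorm_ge zeta (HC hs).
have b0 : 0 <= b h by apply: le_trans h1; exact: opnorm_ge0.
rewrite -exprMn ler_sqr ?nnegrE ?mulr_ge0 ?vnorm_ge0//.
by apply: le_trans (vnorm_mulmx_le _ _) _; rewrite ler_wpM2r ?vnorm_ge0.
Qed.

Lemma supnorm_hop_ge0 (xi : config M A) h : h \in hop_range H -> 0 <= b h.
Proof.
by move=> hs; apply: le_trans (supnorm_ge xi (HC hs)); exact: opnorm_ge0.
Qed.

Lemma ham_norm1_ge0 (xi : config M A) : 0 <= ham_norm1 H.
Proof.
rewrite /ham_norm1 big_seq; apply: sumr_ge0 => h hs.
by rewrite mulr_ge0 ?sqrtr_ge0//; exact: supnorm_hop_ge0.
Qed.

Lemma ham_diff_bound xi eta psi :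
  sqn (H xi psi - H eta psi) <= (2 * ham_norm1 H) ^+ 2 * sqn psi.
Proof.
have -> : 2 * ham_norm1 H = \sum_(h <- hop_range H) (2 * b h) * weight h.
  by rewrite /ham_norm1 mulr_sumr; apply: eq_bigr => h _; rewrite mulrA.
apply: (@hopping_bound (fun psi => H xi psi - H eta psi) _
  (fun h x => hop H h (Defs.shift (- x) xi) - hop H h (Defs.shift (- x) eta))).
- move=> phi x; rewrite ell2B !hamE -sumrB; apply: eq_bigr => h _.
  by rewrite mulmxBl.
- by move=> h hs; rewrite mulr_ge0//; exact: supnorm_hop_ge0.
- move=> h x v hs; rewrite mulmxBl; apply: le_trans (vnorm_sqrB_le _ _) _.
  have h1 := hop_le (Defs.shift (- x) xi) v hs.
  have h2 := hop_le (Defs.shift (- x) eta) v hs.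
  apply: (@le_trans _ _ (2 * (b h ^+ 2 * vnorm v ^+ 2) + 2 * (b h ^+ 2 * vnorm v ^+ 2))).
    exact: lerD (ler_wpM2l (ler0n R 2) h1) (ler_wpM2l (ler0n R 2) h2).
  by rewrite le_eqVlt; apply/orP; left; apply/eqP; ring.
Qed.

(** Rewriting [hop h] through its adjoint [hop (- h)] moves the observation
    point from [x] to [x - h], which lies in the support of [phi]. *)
Lemma ham_local (Munit : M \in unitmx) xi eta (phi : ell2 M N) (y : lattice M) (r r0 : R) :
  (forall h, h \in hop_range H -> Rt h <= r0) ->
  (forall x, phi x != 0 -> gauge M (x - y : lattice M) <= r) ->
  (forall z : lattice M, gauge M (z - y : lattice M) <= r + r0 -> xi z = eta z) ->
  H xi phi = H eta phi.
Proof.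
move=> Rr0 phi_supp agree; apply: val_inj; apply/funext => x.
rewrite /= !hamE; apply: eq_big_seq => h hs.
have [->|nz] := eqVneq (phi (x - h)) 0; first by rewrite !mulmx0.
congr (_ *m _).
have hN := hop_rangeN hs.
have adj zeta : hop H (- h) (Defs.shift (h - x) zeta) =
    ((hop H h (Defs.shift (- x) zeta))^t*)%sesqui.
  rewrite hop_adjoint//; congr ((hop H h _)^t*)%sesqui.
  by apply/funext => z; rewrite /Defs.shift !opprK opprB addrACA subrr addr0.
have E : hop H (- h) (Defs.shift (h - x) xi) = hop H (- h) (Defs.shift (h - x) eta).
  apply: (HR hN).2 => z /(boxE Munit) zr; rewrite /Defs.shift.
  apply: agree; have -> : z - (h - x) - y = (x - h - y) + z.
    by rewrite opprB [RHS]addrC !addrA.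
  apply: le_trans (gaugeD _ _ _) _; apply: lerD; first exact: phi_supp.
  exact: le_trans zr (Rr0 _ hN).
apply/matrixP => i j; move: E; rewrite !adj => /matrixP /(_ j i).
by rewrite !mxE => /(can_inj (@conjCK _)).
Qed.

End Fixed.
End Hopping.

(** * Shadowing of spectra and Lipschitz continuity *)

(** At distances below 1 the bound on the discrete metric forces equality. *)
Lemma config_dist_agree (R : realType) (d : nat) (M : 'M[R]_d) (A : finType)
    (xi eta : config M A) (e : R) :
  M \in unitmx -> 0 < e -> e <= 1 -> config_dist xi eta < e ->
  forall z : lattice M, gauge M z <= e^-1 -> xi z = eta z.
Proof.
move=> Munit e0 e1; rewrite /config_dist gt_min => /orP[|]; last by rewrite ltNge e1.
case/inf_lt.
  by exists 1^-1; exists 1 => //; split=> // x _; rewrite invr1 /alphabet_dist lern1 leq_b1.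
move=> _ [r [r0 rP] <-] re z ze; apply/eqP; apply: contraT => neq.
have er : e^-1 <= r by rewrite -(invrK r) lef_pV2 ?posrE ?invr_gt0// ltW.
have /rP : box M r z by apply/(boxE Munit); exact: le_trans er.
by rewrite /alphabet_dist neq leNgt (lt_le_trans re).
Qed.

(** An approximate eigenvector of [H xi] is first localized in a box of size
    about [1 / (3 * e)] around some [y]. Translating [xi] by [- y], replacing it
    by a nearby element of [Theta] and translating back gives [eta] in [Theta]
    which coincides with [xi] around that box, so that the localized vector is
    an approximate eigenvector of [H eta] as well. *)
Lemma spectral_shadowing (R : realType) (d : nat) (M : 'M[R]_d) : M \in unitmx ->
  exists2 C : R, 0 <= C &
  forall (A : finType) (N : nat) (H : hamiltonian M A N) (Rt Ct : lattice M -> R)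
    (r0 e : R) (Xi Theta : set (config M A)),
  (forall h, h \in hop_range H -> influence_radius (hop H h) (Rt h)) ->
  (forall h, h \in hop_range H -> hop_constant (hop H h) (Rt h) (Ct h)) ->
  1 <= r0 -> (forall h, h \in hop_range H -> Rt h <= r0) ->
  subshift Xi -> subshift Theta -> 0 < e ->
  (forall xi, Xi xi -> exists2 eta, Theta eta & config_dist xi eta < e) ->
  forall xi (l eps : R), Xi xi -> spectrum (H xi) l%:C -> 0 < eps ->
  exists eta (mu : R), [/\ Theta eta, spectrum (H eta) mu%:C &
    `|l - mu| <= C * r0 * ham_norm1 H * e + eps].
Proof.
move=> Munit; have [C0 C00 loc] := localization Munit.
pose C1 := C0 + 1; have C1_ge0 : 0 <= C1 by rewrite addr_ge0.
exists (18 + 6 * C1) => [|A N H Rt Ct r0 e Xi Theta HR HC r01 Rr0 Xis Thetas e0 close].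
  by rewrite addr_ge0// mulr_ge0.
move=> xi l eps Xixi spec eps0.
have [_ _ Xi_shift] := Xis; have [_ _ Theta_shift] := Thetas.
have sym eta : dot_symmetric (H eta).
  by apply: self_adjoint_symmetric; exact: ham_self_adjoint.
have bdd eta : bounded_op (H eta) by exact: ham_bounded.
set n1 := ham_norm1 H.
have n10 : 0 <= n1 by exact: (ham_norm1_ge0 HC).
have r0_gt0 : 0 < r0 by exact: lt_le_trans r01.
have [big|small] := leP 1 (6 * r0 * e).
  (* The distance is too large for localization to help: the trivial bound on
     the norm of a difference of Hamiltonians is enough. *)
  have [eta Thetaeta _] := close xi Xixi.
  have e2 : 0 < eps ^+ 2 / 2 by rewrite divr_gt0// exprn_gt0.
  have [psi psi0 Hpsi] := spectrum_approx (sym xi) (bdd xi) spec e2.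
  have [|||mu mu_spec mu_le] := @spectrum_near _ _ _ _ (H eta) l (3 * n1 + eps)
    psi (sym eta) (bdd eta).
  - by rewrite addr_ge0 ?mulr_ge0// ltW.
  - exact: psi0.
  - have -> : H eta psi - l%:C *: psi = (H xi psi - l%:C *: psi) - (H xi psi - H eta psi).
      by rewrite opprB [RHS]addrC addrA subrK.
    apply: le_trans (sqnB_le _ _) _.
    have h := ham_diff_bound HC xi eta psi.
    have h3 : 0 <= n1 * eps * sqn psi by rewrite !mulr_ge0// ltW.
    have h4 : 0 <= n1 ^+ 2 * sqn psi by rewrite mulr_ge0 ?sqr_ge0// ltW.
    move: Hpsi h h3 h4; rewrite -/n1; move: (sqn psi) (sqn _) (sqn _) => p q r.
    by clear => h1 h2 h3 h4; lra.
  exists eta, mu; split=> //; apply: le_trans mu_le _; rewrite lerD2r.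
  have h1 : n1 <= n1 * (6 * r0 * e) by rewrite ler_peMr.
  have h2 : 0 <= C1 * (r0 * n1 * e) by rewrite !mulr_ge0// ltW.
  by move: h1 h2; clear; lra.
have e_small : e < 6^-1 * r0^-1.
  by rewrite -invfM -[ltRHS]mul1r ltr_pdivlMr ?mulr_gt0// mulrC.
pose t := e^-1; have t0 : 0 < t by rewrite invr_gt0.
have te : t * e = 1 by rewrite mulVf// gt_eqF.
have r0t : 6 * r0 < t.
  by rewrite -(ltr_pM2r e0) te.
have e1 : e <= 1.
  rewrite -te ler_peMl ?(ltW e0)//; apply: le_trans (ltW r0t).
  by move: r01; clear; lra.
(* Two thirds of the radius [t] go to the support [2 * n] of the cutoff; the
   remaining third exceeds the radius of influence. *)
pose n := Num.truncn (t / 3).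
have t30 : 0 <= t / 3 by rewrite divr_ge0// ltW.
have /andP[n_le n_gt] := truncn_itv t30.
rewrite -/n in n_le n_gt.
have n_ge : t / 6 <= n%:R.
  have nS : n.+1%:R = n%:R + 1 :> R by rewrite natr1.
  by move: n_gt r0t r01; rewrite nS; move: (n%:R : R) => m; clear; lra.
have n0 : (0 < n)%N.
  by rewrite -(ltr0n R); apply: lt_le_trans n_ge; rewrite divr_gt0.
have e2 : 0 < eps ^+ 2 / 4 by rewrite divr_gt0// exprn_gt0.
have [psi psi0 Hpsi] := spectrum_approx (sym xi) (bdd xi) spec e2.
pose dl := 6 * C1 * n1 * e + eps.
have dl0 : 0 <= dl by rewrite addr_ge0 ?(ltW eps0)// !mulr_ge0// ltW.
have [y [phi [phi_supp Hphi]]] : exists (y : lattice M) (phi : ell2 M N),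
    (forall x, phi x != 0 -> gauge M (x - y : lattice M) <= (2 * n)%N%:R) /\
    sqn (H xi phi - l%:C *: phi) < dl ^+ 2 * sqn phi.
  apply: (loc N (H xi) (hop_range H) (fun h x => hop H h (Defs.shift (- x) xi))
    (fun h => supnorm (hop H h)) _ _ _ n l (eps ^+ 2 / 4) (dl ^+ 2) psi) => //.
  - by move=> phi x; rewrite hamE.
  - by move=> h; exact: (supnorm_hop_ge0 HC xi).
  - by move=> h x v; exact: (hop_le HC).
  rewrite -/n1.
  have n1n : (n1 / n%:R) ^+ 2 <= (6 * n1 * e) ^+ 2.
    rewrite ler_sqr ?nnegrE ?divr_ge0 ?mulr_ge0 ?(ltW e0)//.
    rewrite ler_pdivrMr ?ltr0n//.
    apply: (@le_trans _ _ (n1 * (t * e))); first by rewrite te mulr1.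
    have := ler_wpM2l (mulr_ge0 n10 (ltW e0)) n_ge.
    by move: (n%:R : R) => m; clear; lra.
  have C0C1 : C0 <= C1 ^+ 2.
    by rewrite /C1 expr2; move: C00; clear => h; have := mulr_ge0 h h; lra.
  have h1 : C0 * (n1 / n%:R) ^+ 2 <= C1 ^+ 2 * (6 * n1 * e) ^+ 2.
    apply: le_trans (ler_wpM2r (sqr_ge0 _) C0C1).
    exact: ler_wpM2l.
  have h2 : 0 <= C1 * n1 * e * eps by rewrite !mulr_ge0// ltW.
  have h3 : 0 < eps ^+ 2 by rewrite exprn_gt0.
  move: h1 h2 h3; rewrite /dl; move: ((n1 / _) ^+ 2) => w; clear => h1 h2 h3.
  by rewrite !expr2 in h1 h3 *; lra.
have phi0 : 0 < sqn phi.
  rewrite lt_neqAle sqn_ge0 andbT eq_sym; apply/eqP => phi_eq0.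
  by move: Hphi; rewrite phi_eq0 mulr0 ltNge sqn_ge0.
have [eta' Thetaeta' close_eta] := close _ (Xi_shift xi (- y) Xixi).
pose eta := Defs.shift y eta'.
have local : H xi phi = H eta phi.
  apply: (ham_local HR Munit Rr0 phi_supp) => z zy.
  rewrite /eta /Defs.shift.
  have <- : Defs.shift (- y) xi (z - y) = eta' (z - y).
    apply: (config_dist_agree Munit e0 e1 close_eta).
    apply: le_trans zy _; rewrite -/t natrM.
    by move: t0 n_le r0t; move: (n%:R : R) => m; clear; lra.
  by rewrite /Defs.shift opprK subrK.
have [|mu mu_spec mu_le] := @spectrum_near _ _ _ _ (H eta) l dl phi (sym eta)
  (bdd eta) dl0 phi0.
  by rewrite -local ltW.
exists eta, mu; split=> //; first exact: Theta_shift.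
apply: le_trans mu_le _; rewrite /dl lerD2r.
have h1 : C1 * n1 * e <= C1 * n1 * e * r0.
  by rewrite ler_peMr// !mulr_ge0// ltW.
have h2 : 0 <= r0 * n1 * e by rewrite !mulr_ge0// ltW.
by move: h1 h2; clear; lra.
Qed.

Lemma sup_fset_ge (R : realType) (I : choiceType) (s : {fset I}) (f : I -> R) h :
  h \in s -> f h <= sup [set f k | k in [set k | k \in s]].
Proof.
move=> hs; apply: sup_upper_bound; last by exists h.
split; first by exists (f h), h.
exists (\sum_(k <- s) `|f k|) => _ [k /= ks <-].
rewrite (big_fsetD1 k)//=; apply: le_trans (ler_norm _) _.
by rewrite lerDl; apply: sumr_ge0.
Qed.

Lemma config_dist_le1 (R : realType) (d : nat) (M : 'M[R]_d) (A : finType)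
    (xi eta : config M A) : mdist xi eta <= 1.
Proof. by rewrite /mdist/= /config_dist ge_min lexx orbT. Qed.

Section Hausdorff.
Context {R : realType} {T : metricType R}.
Implicit Types X Y : set T.

Lemma hausdorffC X Y : hausdorff X Y = hausdorff Y X.
Proof.
rewrite /hausdorff maxC; congr maxe; congr ereal_sup; apply/seteqP; split=> _ [x Xx <-];
  exists x => //; congr ereal_inf; apply/seteqP; split=> _ [y Yy <-]; exists y => //;
  by rewrite metric_sym.
Qed.

Lemma hausdorff_lt X Y (e : R) x : (hausdorff X Y < e%:E)%E -> X x ->
  exists2 y, Y y & mdist x y < e.
Proof.
rewrite /hausdorff gt_max => /andP[+ _] Xx.
move=> /(le_lt_trans (ereal_sup_ubound _)) => /(_ (ereal_inf [set (mdist x y)%:E | y in Y])).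
case/(_ _)/ereal_inf_lt => [|_ [y Yy <-]]; first by exists x.
by rewrite lte_fin; exists y.
Qed.

Lemma hausdorff_le X Y (e : R) :
  (forall x eps, X x -> 0 < eps -> exists2 y, Y y & mdist x y <= e + eps) ->
  (forall y eps, Y y -> 0 < eps -> exists2 x, X x & mdist y x <= e + eps) ->
  (hausdorff X Y <= e%:E)%E.
Proof.
have half (U V : set T) :
    (forall x eps, U x -> 0 < eps -> exists2 y, V y & mdist x y <= e + eps) ->
    (ereal_sup [set ereal_inf [set (mdist x y)%:E | y in V] | x in U] <= e%:E)%E.
  move=> UV; apply: ge_ereal_sup => _ [x Ux <-]; apply/lee_addgt0Pr => eps eps0.
  have [y Vy xy] := UV x eps Ux eps0.
  apply: le_trans (_ : ((mdist x y)%:E <= _)%E); last by rewrite -EFinD lee_fin.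
  by apply: ereal_inf_lbound; exists y.
move=> XY YX; rewrite /hausdorff ge_max (half _ _ XY) /=.
apply: le_trans (half _ _ YX); apply: le_ereal_sup => _ [y Yy <-].
exists y => //; congr ereal_inf; apply/seteqP; split=> _ [x Xx <-]; exists x => //.
- by rewrite metric_sym.
- by rewrite metric_sym.
Qed.

Lemma hausdorff_fin X Y (c : R) : X !=set0 -> Y !=set0 ->
  (forall x y : T, mdist x y <= c) -> exists2 r : R, 0 <= r & hausdorff X Y = r%:E.
Proof.
move=> [x0 Xx0] [y0 Yy0] dc.
have c0 : 0 <= c by apply: le_trans (dc x0 x0); exact: mdist_ge0.
have le_c : (hausdorff X Y <= c%:E)%E.
  apply: hausdorff_le => x eps _ eps0; [exists y0|exists x0] => //.
  - by apply: le_trans (dc _ _) _; rewrite lerDl ltW.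
  - by apply: le_trans (dc _ _) _; rewrite lerDl ltW.
have ge0 : (0 <= hausdorff X Y)%E.
  rewrite /hausdorff le_max; apply/orP; left.
  apply: (@le_trans _ _ (ereal_inf [set (mdist x0 y)%:E | y in Y])).
    by apply: le_ereal_inf_tmp => _ [y _ <-]; rewrite lee_fin mdist_ge0.
  by apply: ereal_sup_ubound; exists x0.
have fin : hausdorff X Y \is a fin_num.
  by rewrite ge0_fin_numE//; apply: le_lt_trans le_c (ltry _).
exists (fine (hausdorff X Y)); first exact: fine_ge0.
by rewrite fineK.
Qed.

End Hausdorff.

Lemma mdist_lt_norm (R : realType) (x y e : R) : `|x - y| < e ->
  mdist (x : R^o) (y : R^o) < e.
Proof.
move=> xy; have : ball (x : R^o) e (y : R^o) by rewrite -ball_normE.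
by rewrite ballEmdist.
Qed.

Theorem proposition1p1 :
  forall (R : realType) (d : nat) (M : 'M[R]_d),
  (0 < d)%N -> M \in unitmx ->
  exists C : R,
  forall (A : finType) (N : nat) (H : hamiltonian M A N)
    (Rt Ct : lattice M -> R),
  (0 < N)%N ->
  (forall h, h \in hop_range H -> influence_radius (hop H h) (Rt h)) ->
  (forall h, h \in hop_range H -> hop_constant (hop H h) (Rt h) (Ct h)) ->
  forall Xi Theta : set (config M A),
  subshift Xi -> subshift Theta ->
  (hausdorff (ham_spectrum H Xi : set R^o) (ham_spectrum H Theta : set R^o) <=
   (C * sup [set Ct h | h in [set h | h \in hop_range H]] *
    sup [set Rt h | h in [set h | h \in hop_range H]] *
    ham_norm1 H)%:E * hausdorff Xi Theta)%E.
Proof.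
move=> R d M _ Munit; have [C C0 shadow] := spectral_shadowing Munit.
exists C => A N H Rt Ct _ HR HC Xi Theta Xis Thetas.
set c := sup [set Ct h | h in _]; set r := sup [set Rt h | h in _].
set n1 := ham_norm1 H.
have [[xi0 Xi0] _ _] := Xis; have [[th0 Th0] _ _] := Thetas.
have n10 : 0 <= n1 by exact: (ham_norm1_ge0 HC).
(* An empty range makes [r] and [c] vanish, but then [ham_norm1 H] does too. *)
have [r0 [r01 Rr0 r0E]] : exists r0 : R, [/\ 1 <= r0,
    forall h, h \in hop_range H -> Rt h <= r0 & C * r0 * n1 <= C * c * r * n1].
  have [empty|[h hs]] := fset_0Vmem (hop_range H).
    exists 1; split=> // [h|]; first by rewrite empty inE.
    by rewrite /n1 /ham_norm1 empty big_seq_fset0 !mulr0.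
  have r1 : 1 <= r by apply: le_trans (sup_fset_ge Rt hs); exact: (HR h hs).1.
  have c1 : 1 <= c by apply: le_trans (sup_fset_ge Ct hs); exact: (HC h hs).1.
  exists r; split=> // [k ks|]; first exact: sup_fset_ge.
  by rewrite ler_wpM2r// -mulrA ler_wpM2l// ler_peMl// (le_trans ler01).
have [s s0 hausE] : exists2 s : R, 0 <= s & hausdorff Xi Theta = s%:E.
  apply: hausdorff_fin; [by exists xi0|by exists th0|exact: config_dist_le1].
rewrite hausE -EFinM.
apply: (@le_trans _ _ (C * r0 * n1 * s)%:E); last by rewrite lee_fin ler_wpM2r.
set K := C * r0 * n1.
have K0 : 0 <= K by rewrite !mulr_ge0// (le_trans ler01).
have half X Y : subshift X -> subshift Y -> hausdorff X Y = s%:E ->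
    forall x eps, ham_spectrum H X x -> 0 < eps ->
    exists2 y, ham_spectrum H Y y & mdist (x : R^o) (y : R^o) <= K * s + eps.
  move=> Xs Ys XYE x eps clx eps0.
  have eps4 : 0 < eps / 4 by rewrite divr_gt0.
  (* The denominator [K + 1] also covers the case [K = 0]. *)
  pose e := s + eps / 4 / (K + 1).
  have K1 : 0 < K + 1 by rewrite ltr_wpDl.
  have se : s < e by rewrite ltrDl divr_gt0.
  have Ke : K * e <= K * s + eps / 4.
    rewrite /e mulrDr lerD2l mulrCA ger_pMr// ler_pdivrMr// mul1r.
    by rewrite lerDl.
  have [l [[xi Xxi /= spec] xl]] := clx _ (nbhsx_ballx x _ eps4).
  have [||eta [mu [Yeta specmu lmu]]] := shadow A N H Rt Ct r0 e X Y HR HC r01 Rr0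
    Xs Ys _ _ xi l (eps / 4) Xxi spec eps4.
  - exact: le_lt_trans se.
  - move=> zeta Xzeta; apply: (hausdorff_lt _ Xzeta).
    by rewrite XYE lte_fin.
  exists mu; first by apply: subset_closure; exists eta.
  apply/ltW/mdist_lt_norm; rewrite -ball_normE /= in xl.
  apply: le_lt_trans (ler_distD l _ _) _.
  move: xl lmu Ke; rewrite -/n1 -/K.
  by move: (`|x - l|) (`|l - mu|) (K * e) (K * s) eps4 => a b f g; clear; lra.
apply: hausdorff_le; first exact: half.
by apply: half => //; rewrite hausdorffC.
Qed.
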